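(* Let $N\in\mathbb{N}_+$. If $v_1,\ldots,v_m\in\mathbb{R}^d$ is a finite sequence of vectors satisfying $\|v_i\|_2=\frac1{\sqrt N}$ for all $i\in[m]$ and $\sum_{i=1}^m v_iv_i^\top=I$, then for any $n<m$ there exists a deterministic algorithm that takes time $O(n(md^2+d^\omega))$ to find a set $S\subseteq[m]$ with $|S|=n$ such that $$\Big\|\sum_{i\in S}v_iv_i^\top\Big\|\le\frac nm+O\Big(\frac1{\sqrt N}\Big).$$
   Context: $\|\cdot\|$ is the spectral norm; $\omega$ is the exponent of matrix multiplication. *)

(* Defs.v *)
From mathcomp Require Import all_boot all_order all_algebra.
From mathcomp Require Import boolp classical_sets reals exp.

Set Implicit Arguments.
Unset Strict Implicit.
Unset Printing Implicit Defensive.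

Import Order.TTheory GRing.Theory Num.Theory.
Local Open Scope ring_scope.

(** * Norms *)

Definition l2norm (R : realType) (d : nat) (x : 'cV[R]_d) : R :=
  Num.sqrt (\sum_i x i 0 ^+ 2).

Definition spectral_norm (R : realType) (p q : nat) (A : 'M[R]_(p, q)) : R :=
  sup [set l2norm (A *m x) | x in [set x : 'cV[R]_q | l2norm x <= 1]]%classic.

(** * Deterministic real-RAM programs

    A program is a fixed piece of syntax, independent of the input and of its
    dimensions.  The memory consists of two-dimensional arrays, named by
    natural numbers: integer arrays and real arrays; a scalar is the cell
    [(0, 0)] of an array.  Only addition, truncated subtraction and comparison
    are available on integers, so that the unit-cost charge cannot be abused
    through fast-growing integers, and there is no rounding from reals to
    integers.  Real arithmetic is exact. *)

Inductive iexp : Type :=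
| IConst of nat
| ILoad of nat & iexp & iexp
| IAdd of iexp & iexp
| ISub of iexp & iexp.

(** The only real constants are images of integers: no information can be
    hidden in the digits of a constant. *)
Inductive rexp : Type :=
| RInt of iexp
| RLoad of nat & iexp & iexp
| RAdd of rexp & rexp
| RSub of rexp & rexp
| RMul of rexp & rexp
| RDiv of rexp & rexp.

Inductive bexp : Type :=
| BILe of iexp & iexp
| BRLe of rexp & rexp
| BNot of bexp
| BAnd of bexp & bexp.

Inductive cmd : Type :=
| Skip
| IStore of nat & iexp & iexp & iexp
| RStore of nat & iexp & iexp & rexp
| Seq of cmd & cmd
| If of bexp & cmd & cmd
| While of bexp & cmd.

Record state (R : Type) := State {
  ints : nat -> nat -> nat -> nat;
  reals : nat -> nat -> nat -> R
}.

Definition upd (T : Type) (f : nat -> nat -> nat -> T) (a i j : nat) (x : T) :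
    nat -> nat -> nat -> T :=
  fun a' i' j' => if [&& a' == a, i' == i & j' == j] then x else f a' i' j'.

Section Semantics.
Context {R : realType}.
Implicit Types (s : state R).

Fixpoint ieval s (e : iexp) : nat :=
  match e with
  | IConst k => k
  | ILoad a i j => ints s a (ieval s i) (ieval s j)
  | IAdd e1 e2 => (ieval s e1 + ieval s e2)%N
  | ISub e1 e2 => (ieval s e1 - ieval s e2)%N
  end.

Fixpoint reval s (e : rexp) : R :=
  match e with
  | RInt k => (ieval s k)%:R
  | RLoad a i j => reals s a (ieval s i) (ieval s j)
  | RAdd e1 e2 => reval s e1 + reval s e2
  | RSub e1 e2 => reval s e1 - reval s e2
  | RMul e1 e2 => reval s e1 * reval s e2
  | RDiv e1 e2 => reval s e1 / reval s e2
  end.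

Fixpoint beval s (b : bexp) : bool :=
  match b with
  | BILe e1 e2 => (ieval s e1 <= ieval s e2)%N
  | BRLe e1 e2 => reval s e1 <= reval s e2
  | BNot b1 => ~~ beval s b1
  | BAnd b1 b2 => beval s b1 && beval s b2
  end.

End Semantics.

(** Cost of evaluating an expression: one unit per node. *)

Fixpoint icost (e : iexp) : nat :=
  match e with
  | IConst _ => 1
  | ILoad _ i j => (icost i + icost j).+1
  | IAdd e1 e2 | ISub e1 e2 => (icost e1 + icost e2).+1
  end.

Fixpoint rcost (e : rexp) : nat :=
  match e with
  | RInt k => (icost k).+1
  | RLoad _ i j => (icost i + icost j).+1
  | RAdd e1 e2 | RSub e1 e2 | RMul e1 e2 | RDiv e1 e2 =>
      (rcost e1 + rcost e2).+1
  end.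

Fixpoint bcost (b : bexp) : nat :=
  match b with
  | BILe e1 e2 => (icost e1 + icost e2).+1
  | BRLe e1 e2 => (rcost e1 + rcost e2).+1
  | BNot b1 => (bcost b1).+1
  | BAnd b1 b2 => (bcost b1 + bcost b2).+1
  end.

(** [exec c s t s']: started in [s], the program [c] halts in [s'] after
    exactly [t] time units. *)
Inductive exec (R : realType) : cmd -> state R -> nat -> state R -> Prop :=
| ExecSkip s : exec Skip s 1 s
| ExecIStore s a i j e :
    exec (IStore a i j e) s (icost i + icost j + icost e).+1
      (State (upd (ints s) a (ieval s i) (ieval s j) (ieval s e)) (reals s))
| ExecRStore s a i j e :
    exec (RStore a i j e) s (icost i + icost j + rcost e).+1
      (State (ints s) (upd (reals s) a (ieval s i) (ieval s j) (reval s e)))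
| ExecSeq c1 c2 s1 s2 s3 t1 t2 :
    exec c1 s1 t1 s2 -> exec c2 s2 t2 s3 -> exec (Seq c1 c2) s1 (t1 + t2) s3
| ExecIfTrue b c1 c2 s s' t :
    beval s b -> exec c1 s t s' -> exec (If b c1 c2) s (bcost b + t).+1 s'
| ExecIfFalse b c1 c2 s s' t :
    ~~ beval s b -> exec c2 s t s' -> exec (If b c1 c2) s (bcost b + t).+1 s'
| ExecWhileTrue b c s1 s2 s3 t1 t2 :
    beval s1 b -> exec c s1 t1 s2 -> exec (While b c) s2 t2 s3 ->
    exec (While b c) s1 (bcost b + t1 + t2).+1 s3
| ExecWhileFalse b c s :
    ~~ beval s b -> exec (While b c) s (bcost b).+1 s.

Lemma exec_deterministic (R : realType) (c : cmd) (s : state R) t1 t2 s1 s2 :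
  exec c s t1 s1 -> exec c s t2 s2 -> t1 = t2 /\ s1 = s2.
Proof.
move=> H1; elim: H1 t2 s2 => {c s t1 s1}.
- by move=> s t2 s2 H2; inversion H2; subst.
- by move=> s a i j e t2 s2 H2; inversion H2; subst.
- by move=> s a i j e t2 s2 H2; inversion H2; subst.
- move=> c1 c2 s1 s2 s3 t1 t2 _ IH1 _ IH2 t s H; inversion H; subst.
  match goal with
  | G1 : exec c1 _ _ _, G2 : exec c2 _ _ _ |- _ =>
      have [? ?] := IH1 _ _ G1; subst; by have [-> ->] := IH2 _ _ G2
  end.
- move=> b c1 c2 s s' t hb _ IH t2 s2 H; inversion H; subst.
    match goal with G : exec c1 _ _ _ |- _ => by have [-> ->] := IH _ _ G end.
  by match goal with G : is_true (~~ _) |- _ => rewrite hb in G end.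
- move=> b c1 c2 s s' t hb _ IH t2 s2 H; inversion H; subst.
    by match goal with G : is_true (beval _ _) |- _ => rewrite G in hb end.
  match goal with G : exec c2 _ _ _ |- _ => by have [-> ->] := IH _ _ G end.
- move=> b c s1 s2 s3 t1 t2 hb _ IH1 _ IH2 t s H; inversion H; subst.
    match goal with
    | G1 : exec c _ _ _, G2 : exec (While b c) _ _ _ |- _ =>
        have [? ?] := IH1 _ _ G1; subst; by have [-> ->] := IH2 _ _ G2
    end.
  by match goal with G : is_true (~~ _) |- _ => rewrite hb in G end.
- move=> b c s hb t2 s2 H; inversion H; subst; last by [].
  by match goal with G : is_true (beval _ _) |- _ => rewrite G in hb end.
Qed.

(** * Inputs and outputs *)

Definition mx_cells (R : realType) (p q : nat) (A : 'M[R]_(p, q)) :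
    nat -> nat -> R :=
  fun i j => if (insub i, insub j) is (Some i', Some j') then A i' j' else 0.

(** [load ks Ms] stores the integers [ks] in the integer scalars [0, 1, ...]
    and the matrices [Ms] in the real arrays [0, 1, ...]; all other cells
    are zero. *)
Definition load (R : realType) (ks : seq nat) (Ms : seq (nat -> nat -> R)) :
    state R :=
  State (fun a i j => if (i == 0%N) && (j == 0%N) then nth 0%N ks a else 0%N)
        (nth (fun _ _ => 0) Ms).

(** The subset of ['I_m] whose indicator is the column [0] of the integer
    array [a]. *)
Definition read_set (R : realType) (m a : nat) (s : state R) : {set 'I_m} :=
  [set i : 'I_m | (0 < ints s a i 0)%N].

(** * The exponent of matrix multiplication *)

(** [tau] is achievable when some program multiplies two [d x d] real matrices
    in time [O(d^tau)]. *)
Definition mulmx_achievable (R : realType) (tau : R) : Prop :=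
  exists (P : cmd) (C : R), forall (d : nat) (A B : 'M[R]_d), (0 < d)%N ->
    exists (t : nat) (s : state R),
      [/\ exec P (load [:: d] [:: mx_cells A; mx_cells B]) t s,
          t%:R <= C * d%:R `^ tau
        & forall i j : 'I_d, reals s 2 i j = (A *m B) i j].

Definition mulmx_exponent (R : realType) : R :=
  inf [set tau : R | mulmx_achievable tau]%classic.

(* Main.v *)
(* The frame condition forces m = N d, so that m d^2 >= d^3 and cubic-time linear
   algebra fits the time bound without fast matrix multiplication.

   Let s = floor (sqrt N) and let the barrier u_k = 1/s + k sh rise by
   sh = 1/(m - d s) = (1/m)/(1 - s/N) per step. With A the sum of the k vectors
   chosen so far, the invariant is A < u_k I and tr (u_k I - A)^-1 <= d s. A step
   raises the barrier to u, which lowers the trace by some D >= sh tr M^2, where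
   M = (u I - A)^-1. A remaining vector v keeps the invariant when
   v^T M^2 v + D v^T M v <= D, by the Sherman-Morrison formula. The remaining
   vectors sum to I - A = (1 - u) I + M^-1, so the left-hand sides add up to
   tr (M^2 (I - A)) + D tr (M (I - A)). Chebyshev's sum inequality gives
   tr (M^2 (I - A)) <= tr (M^2) (1 - k/m) <= D (m - d s) (1 - k/m), while
   tr (M (I - A)) = (1 - u) tr M + d <= d s (1 - k/m); the total is at most
   (m - k) D, hence the minimiser of the criterion qualifies. If u exceeds 1, every
   subset satisfies the bound. The inverse is maintained by rank-one updates
   only: d of them for the barrier shift and one for the new vector. *)
Require Import Defs.
From mathcomp Require Import all_boot all_order all_algebra.
From mathcomp Require Import boolp classical_sets reals exp.
From mathcomp Require Import ring lra zify.

Set Implicit Arguments.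
Unset Strict Implicit.
Unset Printing Implicit Defensive.

Import Order.TTheory GRing.Theory Num.Theory.
Local Open Scope ring_scope.

(** * Positive definite matrices *)

Section PositiveDefinite.
Context {R : realType} {d : nat}.
Implicit Types (X M A : 'M[R]_d) (x y v : 'cV[R]_d).

Definition bilin X x y : R := (x^T *m X *m y) 0 0.

Definition posdef X := X^T = X /\ forall x, x != 0 -> 0 < bilin X x x.

Lemma bilinC X x y : X^T = X -> bilin X x y = bilin X y x.
Proof.
move=> sX; have e : x^T *m X *m y = (y^T *m X *m x)^T.
  by rewrite !trmx_mul trmxK sX mulmxA.
by rewrite /bilin e [LHS]mxE.
Qed.

Lemma bilin_comb X x y c : X^T = X ->
  bilin X (x + c *: y) (x + c *: y) =
  bilin X x x + 2 * c * bilin X x y + c ^+ 2 * bilin X y y.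
Proof.
move=> sX; have := bilinC y x sX; rewrite /bilin => e.
have -> : (x + c *: y)^T = x^T + c *: y^T by rewrite linearD linearZ.
rewrite !mulmxDl !mulmxDr -!scalemxAl -!scalemxAr.
move: e; set a := x^T *m X *m x; set b := x^T *m X *m y.
set b' := y^T *m X *m x; set c' := y^T *m X *m y.
move: a b b' c' => a b b' c' e.
by rewrite !mxE e; ring.
Qed.

Lemma bilin1 x y : bilin 1%:M x y = \sum_i x i 0 * y i 0.
Proof.
by rewrite /bilin mulmx1 mxE; apply: eq_bigr => i _; rewrite mxE.
Qed.

Lemma bilinD X M x y : bilin (X + M) x y = bilin X x y + bilin M x y.
Proof. by rewrite /bilin mulmxDr mulmxDl mxE. Qed.

Lemma bilinB X M x y : bilin (X - M) x y = bilin X x y - bilin M x y.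
Proof. by rewrite /bilin mulmxBr mulmxBl !mxE. Qed.

Lemma bilinZ c X x y : bilin (c *: X) x y = c * bilin X x y.
Proof. by rewrite /bilin -scalemxAr -scalemxAl mxE. Qed.

Lemma bilin_sum (I : finType) (P : pred I) (F : I -> 'M[R]_d) x y :
  bilin (\sum_(i | P i) F i) x y = \sum_(i | P i) bilin (F i) x y.
Proof. by rewrite /bilin mulmx_sumr mulmx_suml summxE. Qed.

Lemma bilin_outer v x : bilin (v *m v^T) x x = ((x^T *m v) 0 0) ^+ 2.
Proof.
rewrite /bilin mulmxA -mulmxA mxE big_ord1 expr2; congr (_ * _).
by rewrite -[v^T *m x]trmxK trmx_mul trmxK mxE.
Qed.

Lemma mxtrace_outer X v : \tr (X *m (v *m v^T)) = bilin X v v.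
Proof. by rewrite mulmxA mxtrace_mulC mulmxA /mxtrace big_ord1. Qed.

Lemma posdef_ge0 X x : posdef X -> 0 <= bilin X x x.
Proof.
case=> _ pX; have [->|/pX/ltW //] := eqVneq x 0.
by rewrite /bilin mulmx0 mxE.
Qed.

Lemma bilin1_gt0 x : x != 0 -> 0 < bilin 1%:M x x.
Proof.
move=> x0; rewrite bilin1 lt_def sumr_ge0 ?andbT; last first.
  by move=> i _; rewrite -expr2 sqr_ge0.
apply: contra x0 => /eqP/psumr_eq0P x0.
apply/eqP/matrixP => i j; rewrite ord1 mxE; apply/eqP.
by rewrite -sqrf_eq0 expr2 x0 // => k _; rewrite -expr2 sqr_ge0.
Qed.

Lemma posdef1 : posdef 1%:M.
Proof. by split; [rewrite trmx1|exact: bilin1_gt0]. Qed.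

Lemma posdefD_outer X c v : posdef X -> 0 <= c -> posdef (X + c *: (v *m v^T)).
Proof.
move=> pX c0; split => [|x x0].
  by rewrite linearD linearZ /= trmx_mul trmxK (proj1 pX).
rewrite bilinD bilinZ bilin_outer ltr_pwDl ?(proj2 pX) //.
by rewrite mulr_ge0 ?sqr_ge0.
Qed.

Lemma posdefZ X c : posdef X -> 0 < c -> posdef (c *: X).
Proof.
move=> [sX pX] c0; split=> [|x x0]; first by rewrite linearZ /= sX.
by rewrite bilinZ mulr_gt0 ?pX.
Qed.

Lemma posdefD X M : posdef X -> posdef M -> posdef (X + M).
Proof.
move=> [sX pX] [sM pM]; split=> [|x x0]; first by rewrite linearD /= sX sM.
by rewrite bilinD addr_gt0 ?pX ?pM.
Qed.

Lemma inv_sym X M : X^T = X -> X *m M = 1%:M -> M^T = M.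
Proof.
move=> sX e; have := congr1 trmx e; rewrite trmx_mul sX trmx1 => e'.
by rewrite -[LHS]mulmx1 -e mulmxA e' mul1mx.
Qed.

Lemma posdef_inv X M : posdef X -> X *m M = 1%:M -> posdef M.
Proof.
move=> pX e; have sM := inv_sym (proj1 pX) e; split=> // x x0.
have -> : bilin M x x = bilin X (M *m x) (M *m x).
  by rewrite /bilin trmx_mul sM -!mulmxA (mulmxA X) e mul1mx.
apply: (proj2 pX); apply: contra x0 => /eqP /(congr1 (mulmx X)).
by rewrite mulmx0 mulmxA e mul1mx => ->.
Qed.

(** The product expands to the identity plus a multiple of [v *m (v^T *m M)]. With [g] the scalar of
    the correction, the coefficient is [c + g * (1 + c * bilin M v v)], which vanishes. Barrier
    shifts use a positive [c], new vectors [c = -1]. *)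
Lemma sherman_morrison X M v c :
    X^T = X -> X *m M = 1%:M -> 1 + c * bilin M v v != 0 ->
  (X + c *: (v *m v^T)) *m
    (M + (- c / (1 + c * bilin M v v)) *: (M *m v *m (M *m v)^T)) = 1%:M.
Proof.
move=> sX e nz; have sM := inv_sym sX e; set g := - c / _.
rewrite mulmxDl !mulmxDr e -!scalemxAl -!scalemxAr !mulmxA e mul1mx.
rewrite trmx_mul sM.
have -> : v *m v^T *m M *m v *m (v^T *m M) = bilin M v v *: (v *m (v^T *m M)).
  rewrite -!(mulmxA v).
  by rewrite [v^T *m M *m v]mx11_scalar mul_scalar_mx -scalemxAr.
rewrite -!(mulmxA v) !scalerA -addrA -!scalerDl.
rewrite (_ : g + _ = 0) ?scale0r ?addr0 //.
by rewrite /g; field.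
Qed.

(** With [c = x^T v], positivity of [X] at [x - c M v] gives [bilin X x x >= c ^+ 2 * (2 - bilin M v
    v)], which exceeds [c ^+ 2] unless [c = 0]. *)
Lemma posdef_subr_outer X M v :
  posdef X -> X *m M = 1%:M -> bilin M v v < 1 -> posdef (X - v *m v^T).
Proof.
move=> pX e q1; have [sX _] := pX; have sM := inv_sym sX e.
split=> [|x x0]; first by rewrite linearB /= trmx_mul trmxK sX.
rewrite bilinB bilin_outer; set c := (x^T *m v) 0 0.
have := posdef_ge0 (x + - c *: (M *m v)) pX.
rewrite bilin_comb //.
have -> : bilin X x (M *m v) = c by rewrite /bilin mulmxA -(mulmxA _ X) e mulmx1.
have -> : bilin X (M *m v) (M *m v) = bilin M v v.
  by rewrite /bilin trmx_mul sM -!mulmxA (mulmxA X) e mul1mx.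
have [c0 _|c0] := eqVneq c 0.
  by rewrite c0 expr0n subr0 (proj2 pX).
have : 0 < c ^+ 2 by rewrite exprn_even_gt0.
by nra.
Qed.

(** The diagonal entries are values of the form [X] at the columns of [B]. This replaces arguments
    with eigenvalues. *)
Lemma mxtrace_congr_ge0 X (B : 'M[R]_d) : posdef X -> 0 <= \tr (B^T *m X *m B).
Proof.
move=> pX; apply: sumr_ge0 => j _.
have -> : (B^T *m X *m B) j j = bilin X (col j B) (col j B).
  by rewrite /bilin tr_col -row_mul colE mulmxA -colE -row_mul [RHS]mxE [RHS]mxE.
exact: posdef_ge0.
Qed.

Lemma posdef_mxtrace_gt0 X : (0 < d)%N -> posdef X -> 0 < \tr X.
Proof.
move=> d0 pX; have eX i : X i i = bilin X (delta_mx i 0) (delta_mx i 0).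
  by rewrite /bilin trmx_delta -rowE -colE [RHS]mxE mxE.
have nz i : (delta_mx i 0 : 'cV[R]_d) != 0.
  apply/eqP => /matrixP /(_ i 0); rewrite !mxE !eqxx /= => /eqP.
  by rewrite oner_eq0.
rewrite /mxtrace (bigD1 (Ordinal d0)) //= ltr_pwDl //.
  by rewrite eX (proj2 pX).
by apply: sumr_ge0 => i _; rewrite eX posdef_ge0.
Qed.

Lemma mxtrace_shift_congr X M c : X^T = X -> M^T = M ->
  \tr ((M - c%:M)^T *m X *m (M - c%:M)) =
  \tr (M *m X *m M) - 2 * c * \tr (X *m M) + c ^+ 2 * \tr X.
Proof.
move=> sX sM; have -> : (M - c%:M)^T = M - c%:M.
  by rewrite linearB /= sM tr_scalar_mx.
rewrite !(mulmxBl, mulmxBr) !mul_scalar_mx !mul_mx_scalar -!scalemxAl.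
rewrite !linearB /= !linearZ /= (mxtrace_mulC M X).
by ring.
Qed.

(* The Chebyshev sum inequality for the eigenvalues of [Y], derived from two
   nonnegative traces. *)
Lemma posdef_chebyshev Y M : (0 < d)%N -> posdef Y -> Y *m M = 1%:M ->
  d%:R * \tr M <= \tr (M *m M) * \tr Y.
Proof.
move=> d0 pY e; have pM := posdef_inv pY e; have t0 := posdef_mxtrace_gt0 d0 pM.
have dR : 0 < d%:R :> R by rewrite ltr0n.
(* With [c] the mean eigenvalue of [M], the two traces give [d <= c * \tr Y] and
   [c ^+ 2 * d <= \tr (M *m M)]; these combine to the claim. *)
set t := \tr M in t0 *; pose c := t / d%:R.
have := mxtrace_congr_ge0 (M - c%:M) posdef1.
have := mxtrace_congr_ge0 (M - c%:M) pY.
rewrite !mxtrace_shift_congr ?trmx1 ?(proj1 pY) ?(proj1 pM) //.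
rewrite -(mulmxA M Y) e mulmx1 mul1mx mxtrace1 -/t.
set t2 := \tr (M *m M); set y := \tr Y => h1 h2.
have c0 : 0 < c by rewrite divr_gt0.
have ec : t = c * d%:R by rewrite /c divfK // gt_eqF.
have {}h1 : d%:R <= c * y.
  have : 0 <= c * (c * y - d%:R) by move: h1; rewrite ec; nra.
  by rewrite pmulr_rge0 // subr_ge0.
have {}h2 : c ^+ 2 * d%:R <= t2 by move: h2; rewrite ec; nra.
have y0 : 0 < y by rewrite -(pmulr_rgt0 _ c0) (lt_le_trans dR).
rewrite ec; apply: le_trans (ler_wpM2r (ltW y0) h2).
have -> : c ^+ 2 * d%:R * y = c * d%:R * (c * y) by ring.
by rewrite mulrCA mulrA ler_wpM2l // mulr_ge0 // ltW.
Qed.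

(** The resolvent identity [M = M' + c *: (M *m M')], used twice, writes the drop as
    [c \tr (M' M') + c^2 \tr (M' M M')], whose last trace is nonnegative. *)
Lemma posdef_potential_drop X M M' (c : R) : 0 <= c -> posdef X ->
    X *m M = 1%:M -> (X + c%:M) *m M' = 1%:M ->
  c * \tr (M' *m M') <= \tr M - \tr M'.
Proof.
move=> c0 pX e e'; have pM := posdef_inv pX e.
have sM' : M'^T = M'.
  by apply: inv_sym e'; rewrite linearD /= (proj1 pX) tr_scalar_mx.
have eM : M = M' + c *: (M *m M').
  rewrite -[LHS]mulmx1 -e' mulmxA mulmxDr (mulmx1C e) mul_mx_scalar mulmxDl.
  by rewrite mul1mx -scalemxAl.
rewrite [in leRHS]eM linearD linearZ /= addrAC subrr add0r ler_wpM2l //.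
rewrite [in leRHS]eM mulmxDl linearD /= lerDl -scalemxAl linearZ /= mulr_ge0 //.
by rewrite mxtrace_mulC mulmxA -{1}sM' mxtrace_congr_ge0.
Qed.

End PositiveDefinite.

(** * The barrier argument *)

Section Barrier.
Context {R : realType} (N m d s : nat) (v : 'I_m -> 'cV[R]_d).
Hypothesis v_norm : forall i, bilin 1%:M (v i) (v i) = N%:R^-1.
Hypothesis v_frame : \sum_(i < m) v i *m (v i)^T = 1%:M.
Hypotheses (N0 : (0 < N)%N) (d0 : (0 < d)%N).
Implicit Types (S : {set 'I_m}) (M : 'M[R]_d).

Definition frame_sum S : 'M[R]_d := \sum_(i in S) v i *m (v i)^T.

Definition shift : R := (m%:R - d%:R * s%:R)^-1.

Definition barrier (k : nat) : R := s%:R^-1 + k%:R * shift.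

(** The inverse is a parameter because the program carries it along as a stored matrix. Its trace is
    the potential that no step may increase. *)
Definition below_barrier S M :=
  let X := (barrier #|S|)%:M - frame_sum S in
  [/\ posdef X, X *m M = 1%:M & \tr M <= d%:R * s%:R].

Lemma barrierS k : barrier k.+1 = barrier k + shift.
Proof. by rewrite /barrier -natr1 mulrDl mul1r addrA. Qed.

Lemma frame_sum_tr S : (frame_sum S)^T = frame_sum S.
Proof.
rewrite /frame_sum linear_sum /=; apply: eq_bigr => i _.
by rewrite trmx_mul trmxK.
Qed.

Lemma mxtrace_frame_sum S : \tr (frame_sum S) = #|S|%:R / N%:R.
Proof.
rewrite /frame_sum linear_sum /= (eq_bigr (fun=> N%:R^-1)).
  by rewrite sumr_const mulr_natl.
by move=> i _; rewrite -[_ *m _]mul1mx mxtrace_outer v_norm.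
Qed.

(** Compare traces in the frame condition: [d] for the identity, [m / N] for the sum. *)
Lemma frame_size : m = (N * d)%N.
Proof.
have e1 : frame_sum [set: 'I_m] = 1%:M.
  by rewrite -v_frame; apply: eq_bigl => i; rewrite inE.
have := mxtrace_frame_sum [set: 'I_m]; rewrite e1 cardsT card_ord mxtrace1 => e.
apply/eqP; rewrite -(eqr_nat R) natrM e mulrC divfK //.
by rewrite pnatr_eq0 -lt0n.
Qed.

Lemma frame_sumC S : \sum_(i in ~: S) v i *m (v i)^T = 1%:M - frame_sum S.
Proof.
rewrite -v_frame [X in _ = X - _](bigID (mem S)) /= addrAC subrr add0r.
by apply: eq_bigl => i; rewrite inE.
Qed.

Lemma frame_sumU1 S i : i \notin S ->
  frame_sum (i |: S) = frame_sum S + v i *m (v i)^T.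
Proof. by move=> iS; rewrite /frame_sum big_setU1 //= addrC. Qed.

Lemma sum_bilin_frameC S M :
  \sum_(i in ~: S) bilin M (v i) (v i) = \tr (M *m (1%:M - frame_sum S)).
Proof.
rewrite -frame_sumC mulmx_sumr linear_sum /=.
by apply: eq_bigr => i _; rewrite mxtrace_outer.
Qed.

Hypotheses (s0 : (0 < s)%N) (sN : (2 * s <= N)%N).

Lemma shift_gt0 : 0 < shift.
Proof.
rewrite invr_gt0 subr_gt0 -natrM ltr_nat frame_size mulnC ltn_pmul2r //.
by nia.
Qed.

Lemma barrier_lt (k : nat) : barrier k < barrier k.+1.
Proof. by rewrite ltrD2l ltr_pM2r ?shift_gt0 // ltr_nat. Qed.

Lemma shift_ge : m%:R^-1 <= shift.
Proof.
have h := shift_gt0; rewrite /shift invr_gt0 in h.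
have ds0 : 0 <= d%:R * s%:R :> R by rewrite mulr_ge0.
have mds : m%:R - d%:R * s%:R <= m%:R :> R by rewrite lerBlDr lerDl.
by rewrite lef_pV2 // posrE // (lt_le_trans h).
Qed.

(** By averaging: if every vector outside [S] failed the criterion, the sum over the complement
    would exceed [(m - #|S|) * D], where [D] is the drop of the trace. *)
Lemma exists_good_vector S M M' :
    below_barrier S M -> (#|S| < m)%N -> barrier #|S|.+1 <= 1 ->
    ((barrier #|S|)%:M - frame_sum S + shift%:M) *m M' = 1%:M ->
  exists2 i, i \notin S &
    bilin (M' *m M') (v i) (v i) + (\tr M - \tr M') * bilin M' (v i) (v i)
      <= \tr M - \tr M'.
Proof.
set k := #|S|; set X := _ - _; set Y := X + _; set u := barrier k.+1.
move=> [pX eX tM] km u1 eY.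
have sh0 := shift_gt0.
have pY : posdef Y.
  by rewrite /Y -scalemx1; apply: posdefD => //; apply: posdefZ => //; exact: posdef1.
have mR : 0 < m%:R :> R by rewrite ltr0n (leq_ltn_trans _ km).
have NR : 0 < N%:R :> R by rewrite ltr0n.
have dR : 0 < d%:R :> R by rewrite ltr0n.
have sR : 0 < s%:R :> R by rewrite ltr0n.
have YE : Y = u%:M - frame_sum S.
  by rewrite /Y /X /u barrierS [in RHS]raddfD /= addrAC.
have FE : 1%:M - frame_sum S = (1 - u)%:M + Y.
  by rewrite YE [in RHS]raddfB /= addrA subrK.
have drop := posdef_potential_drop (ltW sh0) pX eX eY.
have cheb := posdef_chebyshev d0 pY eY.
have trY : \tr Y = d%:R * u - k%:R / N%:R.
  by rewrite YE linearB /= mxtrace_scalar mxtrace_frame_sum -[u *+ d]mulr_natl.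
have t0 := posdef_mxtrace_gt0 d0 (posdef_inv pY eY).
rewrite trY in cheb.
set D := \tr M - \tr M' in drop *; set t := \tr M' in drop t0 cheb *.
set t2 := \tr (M' *m M') in drop cheb.
have t20 : 0 <= t2.
  have := mxtrace_congr_ge0 M' posdef1.
  by rewrite mulmx1 (inv_sym (proj1 pY) eY).
have D0 : 0 <= D by apply: le_trans drop; rewrite mulr_ge0 // ltW.
have [/existsP[i /andP[iS iD]]|] := boolP [exists i,
  (i \notin S) && (bilin (M' *m M') (v i) (v i) + D * bilin M' (v i) (v i) <= D)].
  by exists i.
rewrite negb_exists => /forallP none; exfalso.
have : \sum_(i in ~: S) D < \sum_(i in ~: S)
    (bilin (M' *m M') (v i) (v i) + D * bilin M' (v i) (v i)).
  have cS : (0 < #|~: S|)%N by rewrite cardsCs finset.setCK card_ord subn_gt0.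
  have [i0 i0S] := card_gt0P cS.
  apply: ltr_sum => [|i iS]; first by apply/hasP; exists i0; rewrite ?mem_index_enum.
  by have := none i; rewrite -finset.in_setC iS /= ltNge.
rewrite sumr_const big_split /= -mulr_sumr !sum_bilin_frameC FE.
rewrite (mulmxDr (M' *m M')) (mulmxDr M') !mul_mx_scalar -mulmxA (mulmx1C eY) mulmx1.
rewrite !mxtraceD !mxtraceZ mxtrace1 -/t -/t2 -[D *+ _]mulr_natr.
rewrite cardsCs finset.setCK card_ord natrB ?(ltnW km) // -/k.
apply/negP; rewrite -leNgt.
(* [r] is the fraction of the frame still available. *)
pose r : R := 1 - k%:R / m%:R.
have r0 : 0 <= r by rewrite subr_ge0 ler_pdivrMr // mul1r ler_nat ltnW.
have mkE : m%:R - k%:R = m%:R * r by rewrite /r; field; rewrite gt_eqF.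
have mE : m%:R = N%:R * d%:R :> R by rewrite frame_size natrM.
(* After multiplication by [d], Chebyshev bounds [d * t] by [t2 * (d * u - k / N)]; the terms in [u]
   cancel, and [m = N * d] leaves an equality. *)
have first_term : (1 - u) * t2 + t <= t2 * r.
  rewrite -(ler_pM2l dR) mulrDr (le_trans (lerD (lexx _) cheb)) //.
  by rewrite le_eqVlt; apply/orP; left; apply/eqP; rewrite /r mE; field; rewrite !gt_eqF.
have invsh : shift * (m%:R - d%:R * s%:R) = 1.
  by rewrite /shift mulVf // -invr_eq0 gt_eqF.
have t2r : t2 * r <= D * (m%:R - d%:R * s%:R) * r.
  rewrite ler_wpM2r // -(ler_pM2l sh0) mulrCA invsh mulr1 //.
(* The barrier stays at least [s^-1] above [k / m]. Multiplied by [d * s], this surplus pays for the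
   summand [d] in [second_term]. *)
have u_le : 1 - u <= r - s%:R^-1.
  have : k%:R * m%:R^-1 <= k.+1%:R * shift.
    by apply: ler_pM; rewrite ?invr_ge0 ?ler0n ?ler_nat ?shift_ge.
  by rewrite /u /r /barrier; lra.
have tds : t <= d%:R * s%:R.
  by apply: le_trans tM; rewrite -subr_ge0 -/D.
have second_term : (1 - u) * t + d%:R <= d%:R * s%:R * r.
  have h1 : (1 - u) * t <= (1 - u) * (d%:R * s%:R).
    by rewrite ler_wpM2l // subr_ge0.
  have h2 : (1 - u) * (d%:R * s%:R) <= (r - s%:R^-1) * (d%:R * s%:R).
    by rewrite ler_wpM2r // mulr_ge0 // ltW.
  have h3 : (r - s%:R^-1) * (d%:R * s%:R) = d%:R * s%:R * r - d%:R.
    by field; rewrite gt_eqF.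
  by lra.
rewrite mkE.
(* The two contributions [D * (m - d * s) * r] and [D * d * s * r] add up to [D * m * r]. *)
have : D * ((1 - u) * t + d%:R) <= D * (d%:R * s%:R * r) by rewrite ler_wpM2l.
by nra.
Qed.

(** Write [p] and [q] for the forms of [M' *m M'] and [M'] at [v i]. As [p > 0] and [D >= 0], the
    criterion [p <= D * (1 - q)] forces [q < 1], so positivity survives. The new trace
    [\tr M' + p / (1 - q)] is then at most [\tr M' + D = \tr M]. *)
Lemma below_barrier_step S M M' i :
    below_barrier S M -> i \notin S ->
    ((barrier #|S|)%:M - frame_sum S + shift%:M) *m M' = 1%:M ->
    bilin (M' *m M') (v i) (v i) + (\tr M - \tr M') * bilin M' (v i) (v i)
      <= \tr M - \tr M' ->
  below_barrier (i |: S) (M' + (1 - bilin M' (v i) (v i))^-1 *: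
                               (M' *m v i *m (M' *m v i)^T)).
Proof.
set X := _ - _; set Y := X + _; set D := _ - _; set q := bilin M' _ _.
move=> [pX eX tM] iS eY.
have sh0 := shift_gt0.
have pY : posdef Y.
  by rewrite /Y -scalemx1; apply: posdefD => //; apply: posdefZ => //; exact: posdef1.
have sM' := inv_sym (proj1 pY) eY.
have D0 : 0 <= D.
  apply: le_trans (posdef_potential_drop (ltW sh0) pX eX eY).
  have := mxtrace_congr_ge0 M' posdef1.
  by rewrite mulmx1 sM' => h; rewrite mulr_ge0 // ltW.
have vi0 : v i != 0.
  apply/eqP => vi; have := v_norm i; rewrite vi /bilin mulmx0 mxE => /esym/eqP.
  by rewrite invr_eq0 pnatr_eq0 -leqn0 leqNgt N0.
have pE : bilin (M' *m M') (v i) (v i) = bilin 1%:M (M' *m v i) (M' *m v i).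
  by rewrite /bilin trmx_mul sM' mulmx1 !mulmxA.
have p0 : 0 < bilin (M' *m M') (v i) (v i).
  rewrite pE; apply: (proj2 posdef1); apply: contra vi0 => /eqP.
  by move=> /(congr1 (mulmx Y)); rewrite mulmx0 mulmxA eY mul1mx => ->.
move=> le_pD; have q1 : q < 1 by nra.
have q1' : 0 < 1 - q by rewrite subr_gt0.
have YE : Y - v i *m (v i)^T =
    (barrier #|i |: S|)%:M - frame_sum (i |: S).
  rewrite cardsU1 iS add1n frame_sumU1 // barrierS [in RHS]raddfD /= opprD addrA.
  by congr (_ - _); rewrite addrAC.
rewrite /below_barrier -YE; split.
- exact: posdef_subr_outer eY q1.
- have := @sherman_morrison _ _ Y M' (v i) (-1) (proj1 pY) eY.
  rewrite scaleN1r opprK mulN1r -/q mul1r; apply.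
  by rewrite gt_eqF.
rewrite mxtraceD mxtraceZ -[_ *m (M' *m v i)^T]mul1mx mxtrace_outer -pE.
apply: le_trans tM; rewrite addrC -lerBrDr -/D mulrC ler_pdivrMr //.
by lra.
Qed.

End Barrier.

(** * From the barrier to the spectral norm *)

Section SpectralNorm.
Context {R : realType} {d : nat}.
Implicit Types (A : 'M[R]_d) (x : 'cV[R]_d).

Lemma l2norm_bilin x : l2norm x = Num.sqrt (bilin 1%:M x x).
Proof. by rewrite /l2norm bilin1; congr Num.sqrt; apply: eq_bigr => i _; rewrite expr2. Qed.

(** Put [y = A *m x]. Nonnegativity of the form at [x - u^-1 *: y], together with the upper bound at
    [y], gives [|y|^2 <= u * bilin A x x], which is at most [u ^+ 2] on the unit ball. *)
Lemma spectral_norm_le A u : A^T = A -> 0 < u ->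
  (forall x, 0 <= bilin A x x) -> (forall x, bilin A x x <= u * bilin 1%:M x x) ->
  spectral_norm A <= u.
Proof.
move=> sA u0 A0 Au; apply: ge_sup => [|_ [x /= x1 <-]].
  exists (l2norm (A *m 0)), 0 => //=.
  by rewrite l2norm_bilin /bilin mulmx0 mxE sqrtr0 ler01.
have n0 (y : 'cV[R]_d) : 0 <= bilin 1%:M y y by exact/posdef_ge0/posdef1.
have {}x1 : bilin 1%:M x x <= 1.
  by move: x1; rewrite l2norm_bilin -[leRHS]sqrtr1 ler_sqrt.
rewrite l2norm_bilin -[leRHS]gtr0_norm // -sqrtr_sqr ler_sqrt ?sqr_ge0 //.
set y := A *m x; have := A0 (x + - u^-1 *: y); rewrite bilin_comb //.
have -> : bilin A x y = bilin 1%:M y y.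
  by rewrite /bilin /y trmx_mul sA mulmx1.
have := Au x; have := Au y; set b := bilin 1%:M y y; set a := bilin A x x.
set c := bilin A y y => cb ax h.
have ui : 0 < u^-1 by rewrite invr_gt0.
have h2 : u^-1 ^+ 2 * c <= u^-1 * b.
  have -> : u^-1 * b = u^-1 ^+ 2 * (u * b) by field; rewrite gt_eqF.
  by rewrite ler_wpM2l // sqr_ge0.
have h3 : u^-1 * b <= u by nra.
have -> : b = u * (u^-1 * b) by rewrite mulrA mulfV ?mul1r // gt_eqF.
by rewrite expr2 ler_wpM2l // ltW.
Qed.

End SpectralNorm.

(** * Height of the final barrier and the discrepancy bound *)

Section Discrepancy.
Context {R : realType} (N m d s : nat) (v : 'I_m -> 'cV[R]_d).
Hypothesis v_frame : \sum_(i < m) v i *m (v i)^T = 1%:M.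
Hypothesis v_size : m = (N * d)%N.
Hypotheses (N0 : (0 < N)%N) (s0 : (0 < s)%N) (d0 : (0 < d)%N).
Hypotheses (sN : (s * s <= N)%N) (Ns : (N < s.+1 * s.+1)%N).
Implicit Types S : {set 'I_m}.

Lemma bilin_frame_ge0 (P : pred 'I_m) x :
  0 <= bilin (\sum_(i | P i) v i *m (v i)^T) x x.
Proof.
by rewrite bilin_sum; apply: sumr_ge0 => i _; rewrite bilin_outer sqr_ge0.
Qed.

(** For [1 <= u] any set will do: the complement completes [frame_sum v S] to the identity by a
    nonnegative form. *)
Lemma spectral_norm_frame_sum_le S u :
    0 < u -> posdef (u%:M - frame_sum v S) \/ 1 <= u ->
  spectral_norm (frame_sum v S) <= u.
Proof.
move=> u0 h; apply: spectral_norm_le => //.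
- exact: frame_sum_tr.
- by move=> x; exact: bilin_frame_ge0.
move=> x; case: h => [pu|u1].
  by have := posdef_ge0 x pu; rewrite bilinB subr_ge0 -(scalemx1 _ u) bilinZ.
apply: (@le_trans _ _ (bilin 1%:M x x)); last first.
  by rewrite ler_peMl //; exact/posdef_ge0/posdef1.
by rewrite -subr_ge0 -bilinB -frame_sumC //; exact: bilin_frame_ge0.
Qed.

(** Two excesses of at most [2 / sqrt N] each: the initial height [s^-1], since
    [sqrt N < s + 1 <= 2 s], and the slope, since [m * shift = N / (N - s) <= 1 + 2 / sqrt N] and
    [n / m <= 1]. *)
Lemma barrier_le n : (1 < N)%N -> (n < m)%N ->
  @barrier R m d s n <= n%:R / m%:R + 4 / Num.sqrt N%:R.
Proof.
move=> N1 nm.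
have s2 : (2 * s <= N)%N by nia.
set r : R := Num.sqrt N%:R.
have sR : 0 < s%:R :> R by rewrite ltr0n.
have r0 : 0 < r by rewrite sqrtr_gt0 ltr0n.
have rr : r * r = N%:R by rewrite -expr2 sqr_sqrtr ?ler0n.
have sr : s%:R <= r.
  by rewrite -[leLHS]gtr0_norm // -sqrtr_sqr ler_sqrt ?ler0n // expr2 -natrM ler_nat.
have rs : r <= 2 * s%:R.
  have h : r < s.+1%:R.
    rewrite -[ltRHS]gtr0_norm ?ltr0n // -sqrtr_sqr ltr_sqrt ?exprn_gt0 ?ltr0n //.
    by rewrite expr2 -natrM ltr_nat.
  rewrite -natrM; apply: le_trans (ltW h) _; rewrite ler_nat; lia.
have NR : 0 < N%:R :> R by rewrite ltr0n.
have dR : 0 < d%:R :> R by rewrite ltr0n.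
have mE : m%:R = N%:R * d%:R :> R by rewrite v_size natrM.
have mR : 0 < m%:R :> R by rewrite mE mulr_gt0.
have s2R : 2 * s%:R <= N%:R :> R by rewrite -natrM ler_nat.
have inv_s : s%:R^-1 <= 2 / r.
  by rewrite ler_pdivlMr // mulrC ler_pdivrMr.
have nm1 : n%:R / m%:R <= 1 :> R by rewrite ler_pdivrMr // mul1r ler_nat ltnW.
have sh : @shift R m d s = m%:R^-1 * (N%:R / (N%:R - s%:R)).
  rewrite /shift mE; field; rewrite ?gt_eqF // ?subr_gt0; last first.
    by rewrite -subr_gt0 in s2R *; nra.
  by nra.
have ratio : N%:R / (N%:R - s%:R) <= 1 + 2 / r.
  rewrite ler_pdivrMr; last by lra.
  have e : r * (2 / r) = 2 by rewrite mulrCA mulfV ?mulr1 // gt_eqF.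
  have : 0 < 2 / r by rewrite divr_gt0.
  by nra.
rewrite /barrier sh mulrA.
have : n%:R / m%:R * (N%:R / (N%:R - s%:R)) <= n%:R / m%:R * (1 + 2 / r).
  by rewrite ler_wpM2l // divr_ge0.
have : n%:R / m%:R * (2 / r) <= 2 / r.
  by rewrite ler_piMl // divr_ge0 // ltW.
have -> : 4 / r = 2 / r + 2 / r by rewrite -mulrDl -natrD.
lra.
Qed.

(** For [N = 1] one has [s = 1] and [m = d * s], so the shift degenerates; there the error term 4
    already exceeds the norm 1 of the whole frame sum. *)
Lemma discrepancy_bound S : (#|S| < m)%N ->
    ((1 < N)%N -> @barrier R m d s #|S| < 1 ->
      posdef ((@barrier R m d s #|S|)%:M - frame_sum v S)) ->
  spectral_norm (frame_sum v S) <= #|S|%:R / m%:R + 4 / Num.sqrt N%:R.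
Proof.
move=> Sm h; have [N1|N1] := ltnP 1 N; last first.
  have -> : N = 1%N by lia.
  rewrite sqrtr1 divr1; apply: (@le_trans _ _ 1).
    by apply: spectral_norm_frame_sum_le => //; right.
  by rewrite -[leLHS]add0r lerD ?divr_ge0 // ler1n.
apply: le_trans (barrier_le N1 Sm).
apply: spectral_norm_frame_sum_le.
  rewrite /barrier ltr_pwDl ?invr_gt0 ?ltr0n // mulr_ge0 // /shift invr_ge0.
  have sN' : (s <= N)%N by nia.
  by rewrite -natrM subr_ge0 ler_nat v_size mulnC leq_mul2r sN' orbT.
by have [b1|b1] := ltP (@barrier R m d s #|S|) 1; [left; apply: h|right].
Qed.

End Discrepancy.

(** * Hoare logic with running times *)

Section ProgramLogic.
Context {R : realType}.
Implicit Types (s : state R) (c : cmd) (Q : state R -> Prop).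

(** Total correctness. The time is bounded rather than exact, so that branches of different cost can
    share one bound. *)
Definition wp c s (T : nat) Q : Prop :=
  exists t s', [/\ exec c s t s', (t <= T)%N & Q s'].

Definition set_int s a i j x : state R :=
  State (upd (ints s) a i j x) (reals s).

Definition set_real s a i j x : state R :=
  State (ints s) (upd (reals s) a i j x).

(** A write footprint: [I] lists the integer arrays and [J] the real arrays that may have
    changed. *)
Definition agree (I J : seq nat) s s' : Prop :=
  (forall a i j, a \notin I -> ints s' a i j = ints s a i j) /\
  (forall a i j, a \notin J -> reals s' a i j = reals s a i j).

Lemma upd_same (T : Type) (f : nat -> nat -> nat -> T) a i j x :
  upd f a i j x a i j = x.
Proof. by rewrite /upd !eqxx. Qed.

Lemma upd_other (T : Type) (f : nat -> nat -> nat -> T) a i j x a' i' j' :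
  a' != a -> upd f a i j x a' i' j' = f a' i' j'.
Proof. by rewrite /upd => /negbTE ->. Qed.

Lemma agree_refl I J s : agree I J s s. Proof. by []. Qed.

Lemma agree_sub I J I' J' s s' :
  agree I J s s' -> all [in I'] I -> all [in J'] J -> agree I' J' s s'.
Proof.
move=> [h1 h2] /allP sI /allP sJ; split=> a i j na; [apply: h1|apply: h2].
  by apply: contra na => /sI.
by apply: contra na => /sJ.
Qed.

Lemma agree_trans I J I' J' s1 s2 s3 : agree I J s1 s2 -> agree I' J' s2 s3 ->
  all [in I] I' -> all [in J] J' -> agree I J s1 s3.
Proof.
move=> [h1 h2] h sI sJ; have [h3 h4] := agree_sub h sI sJ.
by split=> a i j na; rewrite ?h3 ?h4 // ?h1 ?h2.
Qed.

Lemma agree_set_int I J s s' a i j x :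
  agree I J s s' -> a \in I -> agree I J s (set_int s' a i j x).
Proof.
move=> [h1 h2] aI; split=> // b k l nb; rewrite /= upd_other ?h1 //.
by apply: contraNneq nb => ->.
Qed.

Lemma agree_set_real I J s s' a i j x :
  agree I J s s' -> a \in J -> agree I J s (set_real s' a i j x).
Proof.
move=> [h1 h2] aJ; split=> // b k l nb; rewrite /= upd_other ?h2 //.
by apply: contraNneq nb => ->.
Qed.

Lemma wp_weaken c s T T' Q Q' :
  wp c s T Q -> (T <= T')%N -> (forall s', Q s' -> Q' s') -> wp c s T' Q'.
Proof.
move=> [t [s' [e tT q]]] TT QQ; exists t, s'; split; rewrite ?(leq_trans tT) //.
exact: QQ.
Qed.

Lemma wp_skip s Q : Q s -> wp Skip s 1 Q.
Proof. by exists 1%N, s; split=> //; constructor. Qed.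

Lemma wp_istore a i j e s Q :
  Q (set_int s a (ieval s i) (ieval s j) (ieval s e)) ->
  wp (IStore a i j e) s (icost i + icost j + icost e).+1 Q.
Proof. by move=> q; do 2 eexists; split; [exact: ExecIStore|by []|]. Qed.

Lemma wp_rstore a i j e s Q :
  Q (set_real s a (ieval s i) (ieval s j) (reval s e)) ->
  wp (RStore a i j e) s (icost i + icost j + rcost e).+1 Q.
Proof. by move=> q; do 2 eexists; split; [exact: ExecRStore|by []|]. Qed.

Lemma wp_seq c1 c2 s T1 T2 Q1 Q :
  wp c1 s T1 Q1 -> (forall s1, Q1 s1 -> wp c2 s1 T2 Q) ->
  wp (Seq c1 c2) s (T1 + T2) Q.
Proof.
move=> [t1 [s1 [e1 tT1 q1]]] /(_ _ q1)[t2 [s2 [e2 tT2 q2]]].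
exists (t1 + t2)%N, s2; split; [exact: ExecSeq e1 e2|exact: leq_add|by []].
Qed.

Lemma wp_if b c1 c2 s T Q :
  (beval s b -> wp c1 s T Q) -> (~~ beval s b -> wp c2 s T Q) ->
  wp (If b c1 c2) s (bcost b + T).+1 Q.
Proof.
move=> h1 h2; have [hb|hb] := boolP (beval s b).
  have [t [s' [e tT q]]] := h1 hb; exists (bcost b + t).+1, s'.
  by split; [exact: ExecIfTrue|rewrite ltnS leq_add2l|].
have [t [s' [e tT q]]] := h2 hb; exists (bcost b + t).+1, s'.
by split; [exact: ExecIfFalse|rewrite ltnS leq_add2l|].
Qed.

(** The index of [Inv] counts completed iterations; the demand [j < n] under a true guard is the
    termination argument. *)
Lemma wp_while b c s T n (Inv : nat -> state R -> Prop) Q :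
    Inv 0%N s ->
    (forall j s', Inv j s' -> beval s' b -> (j < n)%N /\ wp c s' T (Inv j.+1)) ->
    (forall j s', Inv j s' -> ~~ beval s' b -> Q s') ->
  wp (While b c) s (n * (bcost b + T).+1 + (bcost b).+1) Q.
Proof.
move=> I0 body post; suff H k j s' : (j + k = n)%N -> Inv j s' ->
    wp (While b c) s' (k * (bcost b + T).+1 + (bcost b).+1) Q.
  exact: (H n 0%N).
elim: k j s' => [|k IH] j s' jk Ij.
  have [hb|hb] := boolP (beval s' b).
    by have [] := body _ _ Ij hb; rewrite -jk addn0 ltnn.
  by exists (bcost b).+1, s'; split; [exact: ExecWhileFalse|by []|exact: post Ij hb].
have [hb|hb] := boolP (beval s' b); last first.
  exists (bcost b).+1, s'; split; [exact: ExecWhileFalse|exact: leq_addl|].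
  exact: post Ij hb.
have [_ [t1 [s1 [e1 tT1 I1]]]] := body _ _ Ij hb.
have [|t2 [s2 [e2 tT2 q]]] := IH j.+1 s1 _ I1; first by rewrite addSnnS.
exists (bcost b + t1 + t2).+1, s2; split=> //; first exact: ExecWhileTrue e1 e2.
by move: (bcost b) tT1 tT2 => B; nia.
Qed.

Definition ivar x := ILoad x (IConst 0) (IConst 0).
Definition rvar x := RLoad x (IConst 0) (IConst 0).
Definition iset x e := IStore x (IConst 0) (IConst 0) e.
Definition rset x e := RStore x (IConst 0) (IConst 0) e.

Definition for_loop x y c : cmd :=
  Seq (iset x (IConst 0))
    (While (BNot (BILe (ivar y) (ivar x)))
       (Seq c (iset x (IAdd (ivar x) (IConst 1))))).

(** [Inv] is required after the counter update, so it may speak of the counter. Each round adds 9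
    for the guard and 8 for the increment; initialisation (4) and the last guard (9) make 13. *)
Lemma wp_for (x y : nat) c s T n (Inv : nat -> state R -> Prop) :
    x != y -> ints s y 0 0 = n ->
    Inv 0%N (set_int s x 0 0 0) ->
    (forall j s', (j < n)%N -> ints s' x 0 0 = j -> ints s' y 0 0 = n ->
       Inv j s' ->
       wp c s' T (fun s'' => [/\ ints s'' x 0 0 = j, ints s'' y 0 0 = n &
                                 Inv j.+1 (set_int s'' x 0 0 j.+1)])) ->
  wp (for_loop x y c) s (n * (T + 17) + 13) (Inv n).
Proof.
move=> xy yn I0 body.
pose Inv' j s' := [/\ (j <= n)%N, ints s' x 0 0 = j, ints s' y 0 0 = n & Inv j s'].
apply: (@wp_weaken _ _ (4 + (n * (8 + (T + 8)).+1 + 9)) _ (Inv n)) => //; last by nia.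
apply: wp_seq; first by apply: wp_istore; exact: erefl.
move=> s1 <-; apply: (@wp_while _ _ _ (T + 8) n Inv').
- by split=> //=; rewrite ?upd_same // upd_other // eq_sym.
- move=> j s' [jn xj yj Ij] /=; rewrite xj yj -ltnNge => lt; split=> //.
  apply: wp_seq; first exact: (body _ _ lt xj yj Ij).
  move=> s2 [x2 y2 I2]; apply: wp_istore => /=; rewrite x2 addn1.
  by split=> //=; rewrite ?upd_same // upd_other // eq_sym.
move=> j s' [jn xj yj Ij] /=; rewrite xj yj negbK => nj.
by have <- : j = n by apply/eqP; rewrite eqn_leq jn.
Qed.

Definition sum_loop r x y e : cmd :=
  Seq (rset r (RInt (IConst 0))) (for_loop x y (rset r (RAdd (rvar r) e))).

(** The summand is examined only in states that differ from [s] in the counter and the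
    accumulator. *)
Lemma wp_sum (r x y : nat) e s n (F : nat -> R) :
    x != y -> ints s y 0 0 = n ->
    (forall j s', (j < n)%N -> agree [:: x] [:: r] s s' -> ints s' x 0 0 = j ->
       reval s' e = F j) ->
  wp (sum_loop r x y e) s (n * (rcost e + 24) + 18)
    (fun s' => agree [:: x] [:: r] s s' /\ reals s' r 0 0 = \sum_(j < n) F j).
Proof.
move=> xy yn eF; have xI : x \in [:: x] by rewrite inE.
have rI : r \in [:: r] by rewrite inE.
pose Inv j s' := agree [:: x] [:: r] s s' /\ reals s' r 0 0 = \sum_(i < j) F i.
apply: (@wp_weaken _ _ (5 + (n * (rcost e + 7 + 17) + 13)) _ (Inv n)) => //; last by nia.
apply: wp_seq; first by apply: wp_rstore; exact: erefl.
move=> s1 <-; apply: wp_for => //.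
  split; first by apply: agree_set_int => //; exact: agree_set_real.
  by rewrite /= upd_same big_ord0.
move=> j s' jn xj yj [As' sj].
rewrite (_ : rcost e + 7 = (1 + 1 + (3 + rcost e).+1).+1)%N; last by lia.
apply: wp_rstore => /=; split=> //; split.
  by apply: agree_set_int => //; exact: agree_set_real.
by rewrite /= upd_same big_ord_recr /= sj (eF j).
Qed.

End ProgramLogic.

(** * The program *)

(* Names of integer arrays start with [x], of real arrays with [r]. [rV] is the
   input and [xout] the indicator of the selected set; [rM] holds the inverse,
   [rphi] its trace before the barrier shift and [rdrop] the resulting drop. *)
Local Notation xN := 0%N.
Local Notation xm := 1%N.
Local Notation xd := 2%N.
Local Notation xn := 3%N.
Local Notation xout := 4%N.
Local Notation xroot := 5%N.
Local Notation xk := 6%N.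
Local Notation xi := 7%N.
Local Notation xa := 8%N.
Local Notation xb := 9%N.
Local Notation xbest := 10%N.
Local Notation xc := 11%N.
Local Notation rV := 0%N.
Local Notation rM := 1%N.
Local Notation rW := 2%N.
Local Notation rshift := 3%N.
Local Notation rphi := 4%N.
Local Notation rdrop := 5%N.
Local Notation racc := 6%N.
Local Notation rq := 7%N.
Local Notation rp := 8%N.
Local Notation rg := 9%N.
Local Notation rbest := 10%N.

Local Notation zero := (IConst 0).

Definition mulvec : cmd :=
  for_loop xa xd
    (Seq (sum_loop racc xb xd (RMul (RLoad rM (ivar xa) (ivar xb))
                                    (RLoad rV (ivar xi) (ivar xb))))
         (RStore rW (ivar xa) zero (rvar racc))).

(** [rq] receives [v^T M v] and [rp] receives [|M v|^2]. For symmetric [M] the latter is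
    [v^T M^2 v], obtained without forming [M^2]. *)
Definition evaluate : cmd :=
  Seq mulvec
    (Seq (sum_loop rq xa xd (RMul (RLoad rV (ivar xi) (ivar xa))
                                  (RLoad rW (ivar xa) zero)))
         (sum_loop rp xa xd (RMul (RLoad rW (ivar xa) zero)
                                  (RLoad rW (ivar xa) zero)))).

Definition rank_one : cmd :=
  for_loop xa xd
    (for_loop xb xd
       (RStore rM (ivar xa) (ivar xb)
          (RAdd (RLoad rM (ivar xa) (ivar xb))
                (RMul (rvar rg) (RMul (RLoad rW (ivar xa) zero)
                                      (RLoad rW (ivar xb) zero)))))).

(** The multiple of the identity is added as [d] rank-one terms along the basis vectors [e_c].
    Column [c] of the current inverse is [M e_c], and its entry [c] is the form needed in the
    Sherman-Morrison denominator. *)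
Definition shift_inverse : cmd :=
  for_loop xc xd
    (Seq (for_loop xa xd
            (RStore rW (ivar xa) zero (RLoad rM (ivar xa) (ivar xc))))
    (Seq (rset rg (RDiv (RSub (RInt zero) (rvar rshift))
                        (RAdd (RInt (IConst 1))
                              (RMul (rvar rshift) (RLoad rW (ivar xc) zero)))))
         rank_one)).

Definition score_exp : rexp := RAdd (rvar rp) (RMul (rvar rdrop) (rvar rq)).

(* [xbest = m] means that no candidate has been met yet. *)
Definition select : cmd :=
  Seq (iset xbest (ivar xm))
    (for_loop xi xm
       (Seq evaluate
          (If (BAnd (BILe (ILoad xout (ivar xi) zero) zero)
                    (BNot (BAnd (BILe (IAdd (ivar xbest) (IConst 1)) (ivar xm))
                                (BNot (BRLe score_exp (rvar rbest))))))
             (Seq (iset xbest (ivar xi)) (rset rbest score_exp))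
             Skip))).

Definition trace_loop r : cmd :=
  sum_loop r xa xd (RLoad rM (ivar xa) (ivar xa)).

(** [evaluate] runs again after [select], whose scan leaves in [rW] and [rq] the data of the last
    index rather than of the best one. *)
Definition barrier_step : cmd :=
  Seq (trace_loop rphi)
  (Seq shift_inverse
  (Seq (trace_loop rp)
  (Seq (rset rdrop (RSub (rvar rphi) (rvar rp)))
  (Seq select
  (Seq (iset xi (ivar xbest))
  (Seq evaluate
  (Seq (rset rg (RDiv (RInt (IConst 1)) (RSub (RInt (IConst 1)) (rvar rq))))
  (Seq rank_one
       (IStore xout (ivar xi) zero (IConst 1)))))))))).

(** Squares are compared as reals because integer expressions have no product. A linear search is
    affordable since [N <= m * d ^ 2]. *)
Definition isqrt : cmd :=
  While (BRLe (RMul (RInt (IAdd (ivar xroot) (IConst 1)))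
                    (RInt (IAdd (ivar xroot) (IConst 1)))) (RInt (ivar xN)))
    (iset xroot (IAdd (ivar xroot) (IConst 1))).

(** The initial matrix [s I] inverts the initial barrier [s^-1 I]; only its diagonal is written, as
    other cells start at zero. *)
Definition subset_selection : cmd :=
  Seq isqrt
  (Seq (rset rshift (RDiv (RInt (IConst 1))
                          (RSub (RInt (ivar xm))
                                (RMul (RInt (ivar xd)) (RInt (ivar xroot))))))
  (Seq (for_loop xa xd (RStore rM (ivar xa) (ivar xa) (RInt (ivar xroot))))
       (for_loop xk xn barrier_step))).

(** * Matrix-vector products, quadratic forms and rank-one updates *)

Section Procedures.
Context {R : realType} {m d : nat} (v : 'I_m -> 'cV[R]_d).
Hypothesis d0 : (0 < d)%N.
Implicit Types (s : state R) (M X : 'M[R]_d) (S : {set 'I_m}).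

Definition stores p q s r (A : 'M[R]_(p, q)) : Prop :=
  forall (i : 'I_p) (j : 'I_q), reals s r i j = A i j.

Definition loaded s : Prop :=
  [/\ ints s xm 0 0 = m, ints s xd 0 0 = d &
      stores s rV (\matrix_(i < m, j < d) v i j 0)].

Lemma agree_stores p q I J s s' r (A : 'M[R]_(p, q)) :
  agree I J s s' -> r \notin J -> stores s r A -> stores s' r A.
Proof. by move=> [_ h] rJ sA i j; rewrite h. Qed.

Lemma stores_col p s r (w : 'cV[R]_p) :
  stores s r w -> forall a : 'I_p, reals s r a 0 = w a 0.
Proof. by move=> h a; exact: (h a 0). Qed.

Lemma agree_loaded I J s s' : agree I J s s' ->
  [&& xm \notin I, xd \notin I & rV \notin J] -> loaded s -> loaded s'.
Proof.
move=> h /and3P[m1 d1 V1] [em ed eV]; split; rewrite ?(proj1 h) //.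
exact: agree_stores h V1 eV.
Qed.

Lemma wp_mulvec s (i : 'I_m) M :
    loaded s -> ints s xi 0 0 = i -> stores s rM M ->
  wp mulvec s (39 * d ^ 2 + 43 * d + 13) (fun s' =>
    agree [:: xa; xb] [:: racc; rW] s s' /\ stores s' rW (M *m v i)).
Proof.
move=> [em ed eV] ei eM.
pose Inv j s' := agree [:: xa; xb] [:: racc; rW] s s' /\
  forall a : 'I_d, (a < j)%N -> reals s' rW a 0 = (M *m v i) a 0.
apply: (@wp_weaken _ _ _ (d * (d * (15 + 24) + 18 + 8 + 17) + 13) _ (Inv d)).
- apply: wp_for => //; first by split=> //; exact: agree_set_int (agree_refl _ _ _) _.
  move=> j s1 jd xaj _ [A1 W1].
  pose F b := reals s rM j b * reals s rV i b.
  apply: (@wp_seq _ _ _ _ _ 8); first apply: (@wp_sum _ racc xb xd _ _ d F) => //.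
  + by rewrite (proj1 A1).
  + move=> b s2 bd A2 xbb /=; rewrite (proj1 A2) //= xaj xbb (proj1 A2) //=.
    by rewrite (proj1 A1) //= ei !(proj2 A2) // !(proj2 A1).
  move=> s2 [A2 S2].
  have A12 : agree [:: xa; xb] [:: racc; rW] s s2.
    exact: agree_trans A1 A2 _ _.
  apply: wp_rstore => /=; rewrite (proj1 A2) //= xaj; split=> //.
    by rewrite (proj1 A12).
  split; first by apply: agree_set_int => //; exact: agree_set_real.
  move=> a; rewrite ltnS leq_eqVlt => /orP[/eqP aj|aj] /=; last first.
    by rewrite /upd (ltn_eqF aj) /= (proj2 A2) // W1.
  rewrite -aj upd_same S2 mxE; apply: eq_bigr => b _.
  by rewrite /F -aj eM eV mxE.
- by nia.
move=> s' [A1 W1]; split=> // a b; rewrite ord1; exact: W1.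
Qed.

Lemma wp_evaluate s (i : 'I_m) M :
    loaded s -> ints s xi 0 0 = i -> stores s rM M ->
  wp evaluate s (203 * d ^ 2) (fun s' =>
    [/\ agree [:: xa; xb] [:: racc; rW; rq; rp] s s', stores s' rW (M *m v i),
        reals s' rq 0 0 = bilin M (v i) (v i) &
        reals s' rp 0 0 = bilin 1%:M (M *m v i) (M *m v i)]).
Proof.
move=> L ei eM; have [em ed eV] := L.
(* 203 is the sum of all coefficients, since [1 <= d <= d ^ 2]; the other time constants arise in
   the same way, up to rounding. *)
apply: (@wp_weaken _ _ _ ((39 * d ^ 2 + 43 * d + 13) +
  ((d * (13 + 24) + 18) + (d * (11 + 24) + 18))) _ _ _ _ _ (fun s' q => q)).
  apply: wp_seq; first exact: (wp_mulvec L ei eM).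
  move=> s1 [A1 W1].
  apply: wp_seq.
    apply: (@wp_sum _ rq xa xd _ _ d (fun a => reals s rV i a * reals s1 rW a 0)) => //.
      by rewrite (proj1 A1).
    move=> a s2 ad A2 xaa /=; rewrite xaa (proj1 A2) //= (proj1 A1) //= ei.
    by rewrite !(proj2 A2) // (proj2 A1).
  move=> s2 [A2 S2].
  have A12 : agree [:: xa; xb] [:: racc; rW; rq; rp] s s2.
    by apply: (agree_trans _ A2) => //; exact: agree_sub A1 _ _.
  apply: (@wp_weaken _ _ _ (d * (11 + 24) + 18)).
  - apply: (@wp_sum _ rp xa xd _ _ d (fun a => reals s1 rW a 0 * reals s1 rW a 0)) => //.
      by rewrite (proj1 A12).
    by move=> a s3 ad A3 xaa /=; rewrite xaa !(proj2 A3) // !(proj2 A2).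
  - by [].
  move=> s3 [A3 S3]; split.
  - exact: agree_trans A12 A3 _ _.
  - by apply: agree_stores A3 _ _ => //; exact: agree_stores A2 _ W1.
  - rewrite (proj2 A3) // S2 /bilin -mulmxA mxE; apply: eq_bigr => a _.
    by rewrite eV (stores_col W1) !mxE.
  - by rewrite S3 bilin1; apply: eq_bigr => a _; rewrite (stores_col W1).
by nia.
Qed.

Lemma wp_rank_one s M (w : 'cV_d) :
    ints s xd 0 0 = d -> stores s rM M -> stores s rW w ->
  wp rank_one s (90 * d ^ 2) (fun s' =>
    agree [:: xa; xb] [:: rM] s s' /\
    stores s' rM (M + reals s rg 0 0 *: (w *m w^T))).
Proof.
move=> ed eM eW; set M' := M + _.
have M'E a b : M' a b = M a b + reals s rg 0 0 * (w a 0 * w b 0).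
  by rewrite !mxE big_ord1 mxE.
(* The cells preceding [(j, l)] in row-major order. Updating in place is safe: a new entry depends
   on its own old value, [rW] and [rg] only. *)
pose filled j l (a b : nat) := (a < j)%N || (a == j) && (b < l)%N.
pose Inv j l s' := agree [:: xa; xb] [:: rM] s s' /\
  forall a b : 'I_d, reals s' rM a b = if filled j l a b then M' a b else M a b.
have filled_next j (a b : 'I_d) : filled j d a b = filled j.+1 0%N a b.
  by rewrite /filled ltn_ord andbT ltn0 andbF orbF [in RHS]ltnS [in RHS]leq_eqVlt orbC.
apply: (@wp_weaken _ _ _ (d * (d * (30 + 17) + 13 + 17) + 13) _ (Inv d 0%N)).
- apply: (@wp_for _ _ _ _ _ _ _ (fun j => Inv j 0%N)) => //.
    split; first exact: agree_set_int (agree_refl _ _ _) _.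
    by move=> a b; rewrite /filled ltn0 andbF /= eM.
  move=> j s1 jd xaj _ [A1 M1].
  pose Inv1 l s' := ints s' xa 0 0 = j /\ Inv j l s'.
  apply: (@wp_weaken _ _ _ (d * (30 + 17) + 13) _ (Inv1 d)) => //; last first.
    move=> s2 [xaj2 [A2 M2]]; split=> //; first by rewrite (proj1 A2).
    split; first exact: agree_set_int.
    by move=> a b; rewrite /= M2 filled_next.
  apply: wp_for => //; first by rewrite (proj1 A1).
    by split; first rewrite /= upd_other //; split; first exact: agree_set_int.
  move=> l s2 ld xbl _ [xaj2 [A2 M2]].
  apply: wp_rstore => /=; rewrite xaj2 xbl; split=> //.
    by rewrite (proj1 A2).
  split; first by rewrite /= upd_other.
  split; first by apply: agree_set_int => //; exact: agree_set_real.
  move=> a b /=; rewrite /upd /=.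
  pose j' := Ordinal jd; pose l' := Ordinal ld.
  have [aj|aj] := eqVneq (a : nat) j; last first.
    by rewrite M2 /filled (negbTE aj).
  have [bl|bl] /= := eqVneq (b : nat) l; last first.
    rewrite M2 /filled aj eqxx /= (_ : (b < l.+1)%N = (b < l)%N) //.
    by rewrite ltnS leq_eqVlt (negbTE bl).
  rewrite /filled aj bl ltnn eqxx ltnS leqnn /= -aj -bl.
  rewrite M2 /filled aj bl ltnn eqxx ltnn /= !(proj2 A2) //.
  by rewrite M'E -!(stores_col eW) -aj -bl.
- by nia.
by move=> s' [A1 M1]; split=> // a b; rewrite M1 /filled ltn_ord.
Qed.

End Procedures.

(** * The barrier shift of the inverse and the choice of the best vector *)

Section Correctness.
Context {R : realType} {m d : nat} (v : 'I_m -> 'cV[R]_d).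
Hypothesis d0 : (0 < d)%N.
Implicit Types (s : state R) (M X : 'M[R]_d) (S : {set 'I_m}).

(** [M'] exists unconditionally, and its relation to [X] is conditional, because past the barrier 1
    the stored matrix need not be an inverse. *)
Lemma wp_shift_inverse s M :
    ints s xd 0 0 = d -> stores s rM M ->
  wp shift_inverse s (184 * d ^ 3) (fun s' =>
    agree [:: xa; xb; xc] [:: rM; rW; rg] s s' /\
    exists2 M', stores s' rM M' &
      forall X, 0 <= reals s rshift 0 0 -> posdef X -> X *m M = 1%:M ->
        (X + (reals s rshift 0 0)%:M) *m M' = 1%:M).
Proof.
move=> ed eM; set dl := reals s rshift 0 0.
(* The projection onto the first [c] coordinates: after [c] rounds the stored matrix inverts
   [X + dl *: E c]. *)
pose E c : 'M[R]_d := \sum_(i < d | (i < c)%N) delta_mx i i.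
pose Inv c s' := agree [:: xa; xb; xc] [:: rM; rW; rg] s s' /\
  exists2 M', stores s' rM M' &
    forall X, 0 <= dl -> posdef X -> X *m M = 1%:M ->
      posdef (X + dl *: E c) /\ (X + dl *: E c) *m M' = 1%:M.
have E0 : E 0%N = 0 by rewrite /E big_pred0.
have ES c (cd : (c < d)%N) : E c.+1 =
    E c + delta_mx (Ordinal cd) 0 *m (delta_mx (Ordinal cd) 0 : 'cV[R]_d)^T.
  rewrite /E (bigD1 (Ordinal cd)) /= // addrC trmx_delta mul_delta_mx.
  congr (_ + _); apply: eq_bigl => i; rewrite -val_eqE /= ltnS ltn_neqAle.
  by rewrite andbC.
have Ed : E d = 1%:M.
  by rewrite mx1_sum_delta; apply: eq_bigl => i; rewrite ltn_ord.
apply: (@wp_weaken _ _ _ (d * ((d * (12 + 17) + 13) + (22 + 90 * d ^ 2) + 17) + 13)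
          _ (Inv d)).
- apply: wp_for => //.
    split; first exact: agree_set_int (agree_refl _ _ _) _.
    by exists M => // X _ pX e; rewrite E0 scaler0 addr0.
  move=> c s1 cd xcc _ [A1 [M1 eM1 hM1]].
  pose c' := Ordinal cd; pose w : 'cV[R]_d := M1 *m delta_mx c' 0.
  have wE a : w a 0 = M1 a c' by rewrite /w -colE mxE.
  pose Inv1 j s' := [/\ agree [:: xa] [:: rW] s1 s' &
    forall a : 'I_d, (a < j)%N -> reals s' rW a 0 = w a 0].
  apply: (@wp_seq _ _ _ _ _ _ (Inv1 d)).
    apply: wp_for => //; first by rewrite (proj1 A1).
      by split=> //; exact: agree_set_int (agree_refl _ _ _) _.
    move=> j s2 jd xaj _ [A2 W2].
    apply: wp_rstore => /=; rewrite xaj (proj1 A2 xc) // xcc; split=> //.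
      by rewrite (proj1 A2) // (proj1 A1).
    split; first by apply: agree_set_int => //; exact: agree_set_real.
    move=> a; rewrite ltnS leq_eqVlt => /orP[/eqP aj|aj] /=; last first.
      by rewrite /upd (ltn_eqF aj) /= W2.
    by rewrite -aj upd_same (proj2 A2) // wE -eM1.
  move=> s2 [A2 W2].
  have A12 : agree [:: xa; xb; xc] [:: rM; rW; rg] s s2.
    exact: agree_trans A1 A2 _ _.
  apply: (@wp_seq _ _ _ _ 22); first by apply: wp_rstore; exact: erefl.
  move=> s3 <-; set g := reval _ _.
  have gE : g = - dl / (1 + dl * bilin M1 (delta_mx c' 0) (delta_mx c' 0)).
    rewrite /g /= (proj1 A2) // xcc sub0r (proj2 A12) //.
    by rewrite (W2 c') // wE /bilin trmx_delta -rowE -colE !mxE.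
  apply: wp_weaken; first apply: (wp_rank_one d0 (M := M1) (w := w)) => //.
  - by rewrite (proj1 A12).
  - by move=> a b; rewrite /= upd_other // (proj2 A2) // eM1.
  - by move=> a b; rewrite ord1 /= upd_other // W2.
  - by [].
  move=> s4 [A4]; rewrite [reals _ rg 0 0]upd_same gE => M4.
  have A14 : agree [:: xa; xb; xc] [:: rM; rW; rg] s s4.
    exact: agree_trans (agree_set_real _ _ _ A12 _) A4 _ _.
  split; first by rewrite (proj1 A4) //= (proj1 A2).
    by rewrite (proj1 A14).
  split; first exact: agree_set_int.
  eexists; first exact: M4.
  move=> X dl0 pX e; have [pX1 e1] := hM1 X dl0 pX e.
  rewrite ES scalerDr addrA; split; first exact: posdefD_outer.
  apply: sherman_morrison => //; first exact: (proj1 pX1).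
  rewrite gt_eqF // ltr_pwDl // mulr_ge0 // posdef_ge0 //.
  exact: posdef_inv e1.
- by nia.
move=> s' [A1 [M1 eM1 hM1]]; split=> //; exists M1 => // X dl0 pX e.
by have [_] := hM1 X dl0 pX e; rewrite Ed scalemx1.
Qed.

(** The criterion as the program computes it; for symmetric [M] the first term is the form of
    [M *m M]. *)
Definition score (D : R) M (i : 'I_m) : R :=
  bilin 1%:M (M *m v i) (M *m v i) + D * bilin M (v i) (v i).

(** During the scan, either [xbest] is still [m] and all indices seen lie in [S], or it is a
    minimiser among those seen outside [S]. As [#|S| < m], the first case cannot last to the end. *)
Lemma wp_select s M S :
    loaded v s -> stores s rM M ->
    (forall i : 'I_m, (0 < ints s xout i 0)%N = (i \in S)) -> (#|S| < m)%N ->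
  wp select s (300 * (m * d ^ 2)) (fun s' =>
    agree [:: xa; xb; xi; xbest] [:: racc; rW; rq; rp; rbest] s s' /\
    exists i : 'I_m, [/\ ints s' xbest 0 0 = i, i \notin S &
      forall j, j \notin S ->
        score (reals s rdrop 0 0) M i <= score (reals s rdrop 0 0) M j]).
Proof.
move=> L eM eS Sm; have [em ed eV] := L.
set f := score _ M.
have m0 : (0 < m)%N by exact: leq_ltn_trans Sm.
pose Inv k s' := agree [:: xa; xb; xi; xbest] [:: racc; rW; rq; rp; rbest] s s' /\
  (ints s' xbest 0 0 = m /\ (forall j : 'I_m, (j < k)%N -> j \in S) \/
   exists i : 'I_m, [/\ ints s' xbest 0 0 = i, i \notin S,
     reals s' rbest 0 0 = f i &
     forall j : 'I_m, (j < k)%N -> j \notin S -> f i <= f j]).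
apply: (@wp_weaken _ _ _ (6 + (m * (203 * d ^ 2 + (35 + 20).+1 + 17) + 13)) _ (Inv m)).
- apply: wp_seq; first by apply: wp_istore; exact: erefl.
  move=> s0 <-; apply: wp_for => //.
    split; first by apply: agree_set_int => //; exact: agree_set_int (agree_refl _ _ _) _.
    by left; rewrite /= upd_other // upd_same.
  move=> k s1 km xik _ [A1 B1]; pose k' := Ordinal km.
  have L1 := agree_loaded A1 isT L.
  have eM1 : stores s1 rM M by exact: agree_stores A1 _ eM.
  apply: wp_seq; first exact: (wp_evaluate (i := k') d0 L1 xik eM1).
  move=> s2 [A2 _ q2 p2].
  have A12 : agree [:: xa; xb; xi; xbest] [:: racc; rW; rq; rp; rbest] s s2.
    exact: agree_trans A1 A2 _ _.
  have fE : reval s2 score_exp = f k'.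
    by rewrite /= q2 p2 (proj2 A12).
  have xik2 : ints s2 xi 0 0 = k by rewrite (proj1 A2).
  have m2 : ints s2 xm 0 0 = m by rewrite (proj1 A12).
  have S2 : (ints s2 xout k 0 <= 0)%N = (k' \notin S).
    by rewrite (proj1 A12) // -eS -leqNgt.
  have best2 : ints s2 xbest 0 0 = ints s1 xbest 0 0 by rewrite (proj1 A2).
  have rbest2 : reals s2 rbest 0 0 = reals s1 rbest 0 0 by rewrite (proj2 A2).
  rewrite -best2 -rbest2 in B1.
  apply: wp_if.
    move=> hb; have {hb} [kS hb] : k' \notin S /\
        ~~ ((ints s2 xbest 0 0 < m)%N && ~~ (f k' <= reals s2 rbest 0 0)).
      by move: hb; rewrite -fE /= xik2 m2 addn1 S2 => /andP.
    apply: (@wp_seq _ _ _ _ 6 14); first by apply: wp_istore; exact: erefl.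
    move=> s3 <-; apply: wp_rstore; split; first by rewrite /= upd_other.
      by rewrite /= upd_other // (proj1 A12).
    split.
      apply: agree_set_int => //; apply: agree_set_real => //.
      exact: agree_set_int.
    right; exists k'; split=> //.
    move=> j; rewrite ltnS leq_eqVlt => /orP[/eqP jk|jk] jS.
      by rewrite (_ : j = k') //; apply: val_inj.
    case: B1 => [[_ /(_ j jk)]|[i [bi iS ri /(_ j jk jS)]]].
      by rewrite (negbTE jS).
    by move: hb; rewrite bi ltn_ord /= negbK ri; exact: le_trans.
  move=> hb; apply: (@wp_weaken _ _ _ 1 _ (fun s' => s' = s2)) => //; first exact: wp_skip.
  move=> _ ->; split=> //; split; first exact: agree_set_int.
  have {}hb : k' \notin S ->
      (ints s2 xbest 0 0 < m)%N && ~~ (f k' <= reals s2 rbest 0 0).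
    by move=> kS; move: hb; rewrite -fE /= xik2 m2 addn1 S2 kS negbK.
  case: B1 => [[bm hS]|[i [bi iS ri hi]]]; [left|right].
    split; first by rewrite /= upd_other.
    move=> j; rewrite ltnS leq_eqVlt => /orP[/eqP jk|/hS //].
    rewrite (_ : j = k'); last exact: val_inj.
    by apply: contraT => /hb; rewrite bm ltnn.
  exists i; split=> // j; rewrite ltnS leq_eqVlt => /orP[/eqP jk|/hi //] jS.
  have -> : j = k' by exact: val_inj.
  have kS : k' \notin S by rewrite (_ : k' = j) //; apply: val_inj.
  by have := hb kS; rewrite ri -ltNge => /andP[_ /ltW].
- by nia.
move=> s' [A1 [[_ hS]|[i [bi iS _ hi]]]]; split=> //.
  have : S = [set: 'I_m] by apply/setP => j; rewrite hS ?inE.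
  by move=> eT; move: Sm; rewrite eT cardsT card_ord ltnn.
by exists i; split=> // j jS; apply: hi.
Qed.

End Correctness.

(** * One barrier step and the complete algorithm *)

Section SubsetSelection.
Context {R : realType} {N m d : nat} (v : 'I_m -> 'cV[R]_d).
Hypothesis v_norm : forall i, bilin 1%:M (v i) (v i) = N%:R^-1.
Hypothesis v_frame : \sum_(i < m) v i *m (v i)^T = 1%:M.
Hypotheses (N0 : (0 < N)%N) (d0 : (0 < d)%N).
Implicit Types (s : state R) (M X : 'M[R]_d) (S : {set 'I_m}).

(* Once the barrier exceeds 1 nothing is claimed about the stored matrix: any
   set then satisfies the bound. *)
Definition selected q S s : Prop :=
  [/\ loaded v s, reals s rshift 0 0 = shift m d q,
      forall i : 'I_m, (0 < ints s xout i 0)%N = (i \in S) &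
      exists2 M, stores s rM M &
        (1 < N)%N -> barrier m d q #|S| < 1 :> R -> below_barrier q v S M].

Lemma wp_trace_loop r s M :
    ints s xd 0 0 = d -> stores s rM M -> r != rM ->
  wp (trace_loop r) s (d * 31 + 18) (fun s' =>
    agree [:: xa] [:: r] s s' /\ reals s' r 0 0 = \tr M).
Proof.
move=> ed eM rr.
apply: (@wp_weaken _ _ _ (d * (7 + 24) + 18)).
- apply: (@wp_sum _ r xa xd _ _ d (fun a => reals s rM a a)) => //.
  by move=> a s' _ A xaa /=; rewrite xaa (proj2 A) // inE eq_sym.
- by [].
by move=> s' [A e]; split=> //; rewrite e; apply: eq_bigr => i _; rewrite eM.
Qed.

Lemma wp_barrier_step q s S :
    (0 < q)%N -> ((1 < N)%N -> (2 * q <= N)%N) ->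
    selected q S s -> (#|S| < m)%N ->
  wp barrier_step s (909 * (m * d ^ 2)) (fun s' =>
    agree [:: xout; xi; xa; xb; xbest; xc]
          [:: rM; rW; rphi; rdrop; racc; rq; rp; rg; rbest] s s' /\
    exists2 S' : {set 'I_m}, #|S'| = #|S|.+1 & selected q S' s').
Proof.
set I := [:: xout; _; _; _; _; _]; set J := [:: rM; _; _; _; _; _; _; _; _].
move=> q0 qN [L esh eS [M eM hM]] Sm; have [em ed eV] := L.
(* This puts the [d ^ 3] cost of shifting the inverse within [m * d ^ 2]. *)
have dm : (d <= m)%N by rewrite (frame_size v_norm v_frame) // leq_pmull.
have m0 : (0 < m)%N by exact: leq_ltn_trans Sm.
apply: (@wp_weaken _ _ _ ((d * 31 + 18) + (184 * d ^ 3 + ((d * 31 + 18) +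
   (10 + (300 * (m * d ^ 2) + (6 + (203 * d ^ 2 + (12 + (90 * d ^ 2 + 6)))))))))
   _ _ _ _ _ (fun _ h => h)); last first.
- have d1 : (1 <= d ^ 2)%N by rewrite expn_gt0 d0.
  have d2 : (d <= d ^ 2)%N by rewrite leq_pmulr.
  have d3 : (d ^ 3 <= m * d ^ 2)%N by rewrite expnS leq_mul2r dm orbT.
  have d4 : (d ^ 2 <= m * d ^ 2)%N by rewrite leq_pmull.
  by move: d1 d2 d3 d4; move: (d ^ 3)%N (m * d ^ 2)%N (d ^ 2)%N => x y z; lia.
apply: wp_seq; first exact: (wp_trace_loop (r := rphi) ed eM isT).
move=> s1 [A1 phi1].
have eM1 : stores s1 rM M by exact: agree_stores A1 _ eM.
apply: wp_seq.
  by apply: (wp_shift_inverse d0 _ eM1); rewrite (proj1 A1).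
move=> s2 [A2 [M' eM2 hM']].
have A02 : agree I J s s2.
  by apply: (agree_trans _ A2) => //; exact: agree_sub A1 _ _.
apply: wp_seq.
  by apply: (wp_trace_loop (r := rp) _ eM2 isT); rewrite (proj1 A02).
move=> s3 [A3 p3]; have A03 : agree I J s s3 by exact: agree_trans A02 A3 _ _.
apply: (@wp_seq _ _ _ _ 10); first by apply: wp_rstore; exact: erefl.
move=> s4 <-; set s4' := set_real _ _ _ _ _.
set D := \tr M - \tr M'.
have D4 : reals s4' rdrop 0 0 = D.
  by rewrite /s4' /= upd_same p3 (proj2 A3) // (proj2 A2) // phi1.
have A04 : agree I J s s4' by exact: agree_set_real.
have L4 := agree_loaded A04 isT L.
have eM4 : stores s4' rM M'.
  by move=> a b; rewrite /s4' /= upd_other // (proj2 A3) // eM2.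
have eS4 (i : 'I_m) : (0 < ints s4' xout i 0)%N = (i \in S).
  by rewrite /= (proj1 A3) // (proj1 A2) // (proj1 A1).
apply: wp_seq; first exact: (wp_select d0 L4 eM4 eS4 Sm).
rewrite D4 => s5 [A5 [i [best5 iS min_i]]].
have A05 : agree I J s s5 by exact: agree_trans A04 A5 _ _.
apply: (@wp_seq _ _ _ _ 6); first by apply: wp_istore; exact: erefl.
move=> s6 <-; set s6' := set_int _ _ _ _ _.
have A06 : agree I J s s6' by exact: agree_set_int.
have xi6 : ints s6' xi 0 0 = i by rewrite /s6' /= upd_same.
have L6 := agree_loaded A06 isT L.
have eM6 : stores s6' rM M' by exact: agree_stores A5 _ eM4.
apply: wp_seq; first exact: (wp_evaluate (i := i) d0 L6 xi6 eM6).
move=> s7 [A7 W7 q7 _].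
have A07 : agree I J s s7 by exact: agree_trans A06 A7 _ _.
apply: (@wp_seq _ _ _ _ 12); first by apply: wp_rstore; exact: erefl.
move=> s8 <-; set s8' := set_real _ _ _ _ _.
have A08 : agree I J s s8' by exact: agree_set_real.
have eM8 : stores s8' rM M'.
  by move=> a b; rewrite /s8' /= upd_other // (proj2 A7) // eM6.
have W8 : stores s8' rW (M' *m v i).
  by move=> a b; rewrite /s8' /= upd_other // W7.
apply: wp_seq.
  by apply: (wp_rank_one d0 _ eM8 W8); rewrite (proj1 A08).
move=> s9 [A9]; rewrite [reals _ rg 0 0]upd_same /= q7 div1r => M9.
have A09 : agree I J s s9 by exact: agree_trans A08 A9 _ _.
have xi9 : ints s9 xi 0 0 = i by rewrite (proj1 A9) //= (proj1 A7).
apply: wp_istore => /=; rewrite xi9; set s10 := set_int _ _ _ _ _.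
have A010 : agree I J s s10 by exact: agree_set_int.
split=> //; exists (i |: S); first by rewrite cardsU1 iS.
split.
- exact: agree_loaded A010 isT L.
- by rewrite (proj2 A010).
- move=> j; rewrite /= /upd eqxx /= andbT in_setU1 -(inj_eq val_inj) /=.
  case: eqP => //= _; rewrite (proj1 A9) //= (proj1 A7) //= upd_other //.
  by rewrite (proj1 A5) // eS4.
exists (M' + (1 - bilin M' (v i) (v i))^-1 *: (M' *m v i *m (M' *m v i)^T)).
  exact: M9.
move=> N1; rewrite cardsU1 iS add1n => bar1.
have q2 := qN N1.
have sh0 := shift_gt0 v_norm v_frame N0 d0 q0 q2.
(* The barrier only rises, so it was below 1 before the step and the previous invariant is
   available. *)
have bar0 : barrier m d q #|S| < 1 :> R.
  exact: lt_trans (barrier_lt v_norm v_frame N0 d0 q0 q2 _) bar1.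
have below := hM N1 bar0; have [pX eX _] := below.
have sh1 : reals s1 rshift 0 0 = shift m d q by rewrite (proj2 A1).
have eY : ((barrier m d q #|S|)%:M - frame_sum v S + (shift m d q)%:M) *m M' = 1%:M.
  by have := hM' _ _ pX eX; rewrite sh1; apply; exact: ltW.
have sM' : M'^T = M'.
  apply: inv_sym eY; rewrite linearD /= tr_scalar_mx.
  by rewrite (proj1 pX).
have scoreE j : score v D M' j =
    bilin (M' *m M') (v j) (v j) + D * bilin M' (v j) (v j).
  by rewrite /score; congr (_ + _); rewrite /bilin trmx_mul sM' mulmx1 !mulmxA.
apply: (below_barrier_step v_norm v_frame N0 d0 q0 q2 below iS eY).
(* The chosen index minimises the score, so it does at least as well as the vector found by
   averaging. *)
have [j jS jD] := exists_good_vector v_norm v_frame N0 d0 q0 q2 below Sm (ltW bar1) eY.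
by rewrite -scoreE (le_trans (min_i j jS)) // scoreE.
Qed.

Lemma wp_isqrt s : ints s xN 0 0 = N -> ints s xroot 0 0 = 0%N ->
  wp isqrt s (N * 27 + 19) (fun s' => agree [:: xroot] [::] s s' /\
    (ints s' xroot 0 0 * ints s' xroot 0 0 <= N <
      (ints s' xroot 0 0).+1 * (ints s' xroot 0 0).+1)%N).
Proof.
move=> eN e0; pose Inv j s' := [/\ agree [:: xroot] [::] s s',
  ints s' xroot 0 0 = j & (j * j <= N)%N].
apply: (@wp_while _ _ _ _ 8 N Inv) => //.
  move=> j s' [A ej jN] /=; rewrite ej (proj1 A) // eN addn1 -natrM ler_nat => lt.
  (* [j.+1 <= j.+1 * j.+1 <= N] bounds the number of iterations by [N]. *)
  split; first by apply: leq_trans lt; nia.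
  apply: wp_istore => /=; rewrite ej addn1; split=> //; exact: agree_set_int.
move=> j s' [A ej jN] /=; rewrite ej (proj1 A) // eN addn1 -natrM ler_nat.
by rewrite -ltnNge => lt; split=> //; rewrite jN.
Qed.

(** The factor [maxn n 1] pays for the square root and the initial matrix when [n = 0]. *)
Lemma wp_subset_selection n : (n < m)%N ->
  wp subset_selection
    (load [:: N; m; d; n] [:: mx_cells (\matrix_(i < m, j < d) v i j 0)])
    (1046 * (maxn n 1 * (m * d ^ 2)))
    (fun s => #|read_set m xout s| = n /\
       spectral_norm (frame_sum v (read_set m xout s)) <=
         n%:R / m%:R + 4 / Num.sqrt N%:R).
Proof.
move=> nm; set s0 := load _ _.
have mE := frame_size v_norm v_frame N0.
have L0 : loaded v s0.
  by split=> // i j; rewrite /s0 /= /mx_cells !valK.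
apply: (@wp_weaken _ _ _ ((N * 27 + 19) + (20 + ((d * (11 + 17) + 13) +
   (n * (909 * (m * d ^ 2) + 17) + 13))))
   _ _ _ _ _ (fun _ h => h)); last first.
- have Y0 : (0 < m * d ^ 2)%N by rewrite muln_gt0 expn_gt0 d0 (leq_ltn_trans _ nm).
  have NY : (N <= m * d ^ 2)%N.
    by rewrite mE -mulnA leq_pmulr // muln_gt0 d0 expn_gt0 d0.
  have dY : (d <= m * d ^ 2)%N.
    by rewrite expnS mulnCA leq_pmulr // muln_gt0 expn_gt0 d0 (leq_ltn_trans _ nm).
  have [n1 n2] : (n <= maxn n 1)%N /\ (1 <= maxn n 1)%N by rewrite leq_maxl leq_maxr.
  by move: (m * d ^ 2)%N (maxn n 1) Y0 NY dY n1 n2 => y z; nia.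
apply: wp_seq; first exact: wp_isqrt.
move=> s1 [A1 root1]; set q := ints s1 xroot 0 0 in root1.
have /andP[qN Nq] := root1.
have q0 : (0 < q)%N by case: (q) Nq => //; rewrite mul1n ltnNge N0.
have q2 : (1 < N)%N -> (2 * q <= N)%N by move=> N1; nia.
have L1 := agree_loaded A1 isT L0.
have [em ed _] := L1.
apply: (@wp_seq _ _ _ _ 20); first by apply: wp_rstore; exact: erefl.
move=> s2 <-; set s2' := set_real _ _ _ _ _.
have A2 : agree [:: xroot] [:: rshift] s0 s2'.
  by apply: agree_set_real => //; exact: agree_sub A1 _ _.
have sh2 : reals s2' rshift 0 0 = shift m d q.
  by rewrite /s2' /= upd_same div1r em ed.
have z2 a b : reals s2' rM a b = 0 by rewrite (proj2 A2).
pose Init j s := agree [:: xroot; xa] [:: rshift; rM] s0 s /\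
  [/\ ints s xroot 0 0 = q, reals s rshift 0 0 = shift m d q &
      forall a b : 'I_d, reals s rM a b = if (a == b) && (a < j)%N then q%:R else 0].
apply: (@wp_seq _ _ _ _ _ _ (Init d)).
  apply: wp_for => //.
    split; first by apply: agree_set_int => //; exact: agree_sub A2 _ _.
    by split=> // a b; rewrite ltn0 andbF; exact: z2.
  move=> a s3 ad xa3 _ [A3 [root3 sh3 M3]].
  apply: wp_rstore => /=; rewrite xa3 root3; split=> //.
    by rewrite (proj1 A3).
  split.
    by apply: agree_set_int => //; exact: agree_set_real.
  split=> // b c; rewrite /= /upd /=.
  have [ba|ba] /= := eqVneq (b : nat) a; last first.
    by rewrite M3 ltnS [in RHS]leq_eqVlt (negbTE ba).
  rewrite -ba ltnS leqnn andbT; have [->|cb] := eqVneq c b; first by rewrite eqxx.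
  have /negbTE -> : (c : nat) != b by [].
  by rewrite M3 eq_sym (negbTE cb).
move=> s3 [A3 [_ sh3 M3]].
pose Inv k s := [/\ (k <= n)%N, ints s xn 0 0 = n &
  exists2 S : {set 'I_m}, #|S| = k & selected q S s].
apply: (@wp_weaken _ _ _ (n * (909 * (m * d ^ 2) + 17) + 13) _ (Inv n)) => //.
- apply: wp_for => //; first by rewrite (proj1 A3).
    split=> //; first by rewrite /= upd_other // (proj1 A3).
    exists (finset.set0 : {set 'I_m}); first by rewrite cards0.
    split=> //.
    + apply: agree_loaded (agree_set_int _ _ _ (agree_refl [:: xk] [::] _) _) isT _.
        by [].
      exact: agree_loaded A3 isT L0.
    + by move=> i; rewrite /= upd_other // (proj1 A3) //= inE; case: (_ && _).
    (* Its trace is exactly [d * q], so the potential starts at its bound. *)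
    exists (q%:R%:M).
      by move=> a b; rewrite /= M3 ltn_ord andbT mxE; case: eqP => //.
    move=> N1 _; rewrite /below_barrier cards0 /barrier mul0r addr0 /frame_sum big_set0 subr0.
    have qR : 0 < q%:R :> R by rewrite ltr0n.
    split.
    + by rewrite -scalemx1; apply: posdefZ; [exact: posdef1|rewrite invr_gt0].
    + by rewrite -scalar_mxM mulVf // gt_eqF.
    + by rewrite mxtrace_scalar mulr_natl.
  move=> k s4 kn xk4 xn4 [_ _ [S Sk sel]].
  apply: (@wp_weaken _ _ _ (909 * (m * d ^ 2))).
  + by apply: (wp_barrier_step q0 q2 sel); rewrite Sk (ltn_trans kn).
  + by [].
  move=> s5 [A5 [S' S'k [L5 sh5 eS5 hM5]]].
  split; [by rewrite (proj1 A5)|by rewrite (proj1 A5)|].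
  split=> //; first by rewrite /= upd_other // (proj1 A5).
  exists S'; first by rewrite S'k Sk.
  by split=> //; exact: agree_loaded (agree_set_int _ _ _ (agree_refl [:: xk] [::] _) _) isT L5.
move=> s [_ _ [S Sn [_ _ eS [M eM hM]]]].
have -> : read_set m xout s = S by apply/setP => i; rewrite inE eS.
split=> //; rewrite -Sn.
apply: (discrepancy_bound v_frame mE N0 q0 d0 qN Nq); first by rewrite Sn.
by move=> N1 bar; have [] := hM N1 bar.
Qed.

End SubsetSelection.

Theorem theorem10p4 (R : realType) :
  exists (P : cmd) (C K : R),
    forall (N m d : nat) (v : 'I_m -> 'cV[R]_d),
      (0 < N)%N ->
      (forall i : 'I_m, l2norm (v i) = 1 / Num.sqrt N%:R) ->
      \sum_(i < m) v i *m (v i)^T = 1%:M ->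
      forall n : nat, (n < m)%N ->
        exists (t : nat) (s : state R),
          let S := read_set m 4 s in
          [/\ exec P (load [:: N; m; d; n]
                           [:: mx_cells (\matrix_(i < m, j < d) v i j 0)]) t s,
              t%:R <= C * ((maxn n 1)%:R *
                           (m%:R * d%:R ^+ 2 + d%:R `^ mulmx_exponent R)),
              #|S| = n
            & spectral_norm (\sum_(i in S) v i *m (v i)^T)
                <= n%:R / m%:R + K / Num.sqrt N%:R].
Proof.
exists subset_selection, 1046, 4 => N m d v N0 v_l2 v_frame n nm.
have v_norm i : bilin 1%:M (v i) (v i) = N%:R^-1.
  have := congr1 (fun x => x ^+ 2) (v_l2 i); rewrite l2norm_bilin.
  rewrite sqr_sqrtr; last exact/posdef_ge0/posdef1.
  by rewrite expr_div_n expr1n sqr_sqrtr // div1r.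
(* As [n < m] there is a vector, and its nonzero norm excludes dimension 0. *)
have d0 : (0 < d)%N.
  case: d v {v_l2 v_frame} v_norm => // v /(_ (Ordinal nm)) /esym/eqP.
  by rewrite bilin1 big_ord0 invr_eq0 pnatr_eq0 -leqn0 leqNgt N0.
have [t [s [e tT [Sn bound]]]] := wp_subset_selection v_norm v_frame N0 d0 nm.
exists t, s; split=> //.
apply: (@le_trans _ _ (1046 * (maxn n 1 * (m * d ^ 2)))%N%:R); first by rewrite ler_nat.
rewrite 3!natrM natrX ler_wpM2l // ler_wpM2l // lerDl.
exact: powR_ge0.
Qed.
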